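(* Let $R$ be a residually finite Dedekind domain with field of fractions $K$, let $A$ be a finite-dimensional semisimple $K$-algebra, and let $\Lambda$ be an $R$-order of $A$. Let $\mathfrak p_1,\dotsc,\mathfrak p_r$ be the distinct non-zero prime ideals of $R$ whose square divides $\mathrm{disc}(\Lambda)$. For each $1\le i\le r$ let $S_i$ be the set produced by the following procedure: start with $\mathcal T=\mathcal S=\{\Lambda\}$; while $\mathcal S\neq\emptyset$, remove an element $\Gamma$ from $\mathcal S$, let $\mathcal N$ be the set of all minimal overorders of $\Gamma$ contained in $\mathfrak p_i^{-1}\Gamma$, and replace $\mathcal T$ by $\mathcal T\cup\mathcal N$ and $\mathcal S$ by $\mathcal S\cup\mathcal N$; when $\mathcal S=\emptyset$, return $S_i=\mathcal T$. Then each of these procedures terminates, $S_i$ is exactly the set of all $\mathfrak p_i$-overorders of $\Lambda$, and the set of all overorders of $\Lambda$ is exactly $$\Bigl\{\sum_{1\le i\le r}\Lambda_i \;\Big|\; (\Lambda_1,\dotsc,\Lambda_r)\in S_1\times\dotsb\times S_r\Bigr\}$$ (to be read as $\{\Lambda\}$ if $r=0$).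
   Context: A Dedekind domain $R$ is residually finite if $R/\mathfrak a$ is finite for every non-zero ideal $\mathfrak a$. An $R$-order of $A$ is a subring $\Lambda\subseteq A$ (containing $1$) that is an $R$-subalgebra, finitely generated and projective as an $R$-module, and contains a $K$-basis of $A$. An overorder of $\Lambda$ is an $R$-order $\Gamma$ of $A$ with $\Lambda\subseteq\Gamma$. A minimal overorder of $\Gamma$ is an overorder $\Gamma'\supsetneq\Gamma$ such that there is no order strictly between $\Gamma$ and $\Gamma'$. For a finitely generated torsion $R$-module $T\cong\bigoplus_j R/\mathfrak a_j$ the order ideal is $\mathrm{ord}(T)=\prod_j\mathfrak a_j$, and $[\Gamma:\Lambda]=\mathrm{ord}(\Gamma/\Lambda)$ is the index ideal. For a non-zero prime $\mathfrak p$ of $R$, a $\mathfrak p$-overorder of $\Lambda$ is an overorder $\Gamma$ such that $[\Gamma:\Lambda]$ is a power of $\mathfrak p$ (including $\mathfrak p^0=R$, i.e. $\Gamma=\Lambda$). With $n=\dim_K A$ and $\mathrm{tr}\colon A\to K$ the reduced trace, $\mathrm{disc}(\Lambda)$ is the ideal of $R$ generated by all $\det(\mathrm{tr}(x_ix_j))_{1\le i,j\le n}$ with $x_1,\dotsc,x_n\in\Lambda$. Standing assumption: the bilinear form $(x,y)\mapsto\mathrm{tr}(xy)$ on $A$ is non-degenerate, so $\mathrm{disc}(\Lambda)\neq 0$. *)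

(* Defs.v *)
From mathcomp Require Import all_boot all_order all_algebra all_field.
From mathcomp Require Import boolp classical_sets functions.
From Stdlib Require Import Relation_Operators.

Set Implicit Arguments.
Unset Strict Implicit.
Unset Printing Implicit Defensive.

Import GRing.Theory.
Local Open Scope classical_set_scope.
Local Open Scope ring_scope.

Notation "x %:F" := (@tofrac _ x) : ring_scope.

Section Ideals.
Variable R : idomainType.
Implicit Types (a b p : set R).

Record is_ideal a : Prop := IsIdeal {
  ideal0 : a 0;
  idealD : forall x y, a x -> a y -> a (x + y);
  idealM : forall r x, a x -> a (r * x) }.

Definition ideal_gen (S : set R) : set R :=
  [set x | exists s : seq (R * R),
     (forall i, i \in s -> S i.2) /\ x = \sum_(i <- s) i.1 * i.2].

Definition ideal_mul a b : set R :=
  ideal_gen [set z | exists x y, [/\ a x, b y & z = x * y]].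

Definition ideal_exp p (k : nat) : set R := iter k (ideal_mul p) setT.

Definition ideal_divides a b : Prop := exists2 c, is_ideal c & b = ideal_mul a c.

Definition is_prime_ideal p : Prop :=
  [/\ is_ideal p, ~ p 1 & forall x y, p (x * y) -> p x \/ p y].

Definition is_maximal_ideal p : Prop :=
  [/\ is_ideal p, ~ p 1 &
      forall a, is_ideal a -> p `<=` a -> a = p \/ a = setT].

(* Fields are not excluded. *)
Record is_dedekind : Prop := IsDedekind {
  dedekind_noetherian :
    forall a, is_ideal a -> exists s : seq R, a = ideal_gen [set` s];
  dedekind_integrally_closed :
    forall x : {fraction R}, integralOver (@tofrac R) x -> exists r, x = r%:F;
  dedekind_dim_le1 :
    forall p, is_prime_ideal p -> p <> [set 0] -> is_maximal_ideal p }.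

Definition residually_finite : Prop :=
  forall a, is_ideal a -> a <> [set 0] ->
  exists s : seq R, forall x, exists2 y, y \in s & a (x - y).

Definition ideal_inv p : set {fraction R} :=
  [set x | forall r, p r -> exists t, x * r%:F = t%:F].

End Ideals.

Section SemisimpleAlgebras.
Variables (K : fieldType) (A : falgType K).
Implicit Types (U I J : {vspace A}).

(* Left and two-sided ideals of A are automatically K-subspaces. *)
Definition left_ideal U : Prop := ({:A} * U <= U)%VS.

Definition minimal_left_ideal U : Prop :=
  [/\ left_ideal U, U <> 0%VS &
      forall V, left_ideal V -> (V <= U)%VS -> V = 0%VS \/ V = U].

Definition semisimple : Prop :=
  exists (k : nat) (U : 'I_k -> {vspace A}),
    [/\ forall i, minimal_left_ideal (U i), directv (\sum_(i < k) U i)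
      & (\sum_(i < k) U i)%VS = fullv].

Definition two_sided_ideal I : Prop := ({:A} * I <= I)%VS /\ (I * {:A} <= I)%VS.

Definition simple_component I : Prop :=
  [/\ two_sided_ideal I, I <> 0%VS &
      forall J, two_sided_ideal J -> (J <= I)%VS -> J = 0%VS \/ J = I].

Definition wedderburn_decomposition k (I : 'I_k -> {vspace A}) : Prop :=
  [/\ forall i, simple_component (I i), directv (\sum_(i < k) I i)
    & (\sum_(i < k) I i)%VS = fullv].

(* For a simple component I with centre L = 'Z(I), the field E is an extension
   of L through sigma, and e (x) x |-> e *: phi x is an isomorphism of
   E-algebras from E (x)_L I to 'M[E]_n: phi is multiplicative on I, restricts
   to sigma on L, and sends some L-basis b of I to an E-basis of 'M[E]_n.
   Only the values of phi on I and of sigma on L matter.  Unitality of phi,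
   0 < n, and the fact that sigma is a field embedding all follow. *)
Definition splitting I (E : fieldType) (n : nat)
    (sigma : A -> E) (phi : A -> 'M[E]_n) : Prop :=
  [/\ {in I &, {morph phi : x y / x + y}},
      {in I &, forall x y, phi (x * y) = phi x *m phi y},
      {in 'Z(I)%VS, forall z, phi z = (sigma z)%:M}
    & exists (m : nat) (b : 'I_m -> A),
      [/\ forall j, b j \in I,
          forall x, x \in I -> exists! c : {ffun 'I_m -> A},
            (forall j, c j \in 'Z(I)%VS) /\ x = \sum_j c j * b j
        & basis_of fullv [seq phi (b j) | j <- enum 'I_m]]].

(* t is the reduced trace of the central simple 'Z(I)-algebra I. *)
Definition is_central_reduced_trace I (t : A -> A) : Prop :=
  exists (E : fieldType) (n : nat) (sigma : A -> E) (phi : A -> 'M[E]_n),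
    splitting I sigma phi /\
    {in I, forall x, t x \in 'Z(I)%VS /\ sigma (t x) = \tr (phi x)}.

(* The trace over K of multiplication by z on the subalgebra L. *)
Definition field_trace (L : {vspace A}) (z : A) : K :=
  \sum_(i < \dim L) coord (vbasis L) i (z * (vbasis L)`_i).

Definition is_reduced_trace (tr : A -> K) : Prop :=
  exists (k : nat) (I : 'I_k -> {vspace A}) (t : 'I_k -> A -> A),
    [/\ wedderburn_decomposition I,
        forall i, is_central_reduced_trace (I i) (t i)
      & forall x : 'I_k -> A, (forall i, x i \in I i) ->
          tr (\sum_i x i) = \sum_i field_trace 'Z(I i)%VS (t i (x i))].

Definition trace_form_nondegenerate (tr : A -> K) : Prop :=
  forall x, (forall y, tr (x * y) = 0) -> x = 0.

End SemisimpleAlgebras.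

Section Orders.
Variables (R : idomainType) (A : falgType {fraction R}).
Implicit Types (Lam Gam Del : set A) (p : set R).

Definition Rspan (S : set A) : set A :=
  [set x | exists s : seq (R * A),
     (forall i, i \in s -> S i.2) /\ x = \sum_(i <- s) i.1%:F *: i.2].

Definition fin_generated Lam : Prop := exists s : seq A, Lam = Rspan [set` s].

(* Lifting property for R-linear maps out of Lam; such a map is represented by
   a function on A, of which only the values on Lam matter. *)
Definition Rlinear_on Lam (M : lmodType R) (f : A -> M) : Prop :=
  forall (r : R) x y, Lam x -> Lam y -> f (r%:F *: x + y) = r *: f x + f y.

Definition projective Lam : Prop :=
  forall (M N : lmodType R) (g : {linear M -> N}) (f : A -> N),
    (forall y, exists x, g x = y) -> Rlinear_on Lam f ->
    exists h : A -> M,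
      Rlinear_on Lam h /\ forall x, Lam x -> g (h x) = f x.

Record is_order Lam : Prop := IsOrder {
  order1 : Lam 1;
  orderB : forall x y, Lam x -> Lam y -> Lam (x - y);
  orderM : forall x y, Lam x -> Lam y -> Lam (x * y);
  orderZ : forall (r : R) x, Lam x -> Lam (r%:F *: x);
  order_fin_generated : fin_generated Lam;
  order_projective : projective Lam;
  order_basis : exists2 b : seq A, basis_of fullv b & [set` b] `<=` Lam }.

Definition overorder Lam Gam : Prop := is_order Gam /\ Lam `<=` Gam.

Definition minimal_overorder Gam Gam' : Prop :=
  [/\ overorder Gam Gam', Gam' <> Gam &
      forall Del, is_order Del -> Gam `<=` Del -> Del `<=` Gam' ->
        Del = Gam \/ Del = Gam'].

(* c is the index ideal [Gam : Lam]: sending the j-th generator to the class of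
   x j is an isomorphism from the direct sum of the R/a_j to Gam/Lam, and c is
   the product of the a_j. *)
Definition is_index_ideal Gam Lam (c : set R) : Prop :=
  exists (k : nat) (a : 'I_k -> set R) (x : 'I_k -> A),
    [/\ forall j, is_ideal (a j) /\ a j <> [set 0],
        forall j, Gam (x j),
        forall y, Gam y -> exists r : 'I_k -> R,
          Lam (y - \sum_j (r j)%:F *: x j),
        forall r : 'I_k -> R,
          Lam (\sum_j (r j)%:F *: x j) <-> forall j, a j (r j)
      & c = \big[@ideal_mul R/setT]_(j < k) a j].

Definition p_overorder p Lam Gam : Prop :=
  overorder Lam Gam /\ exists k : nat, is_index_ideal Gam Lam (ideal_exp p k).

(* On an order the trace takes values in R, so every determinant
   \det (tr (x i * x j)) with x i in Lam has the form d%:F. *)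
Definition disc (tr : A -> {fraction R}) Lam : set R :=
  ideal_gen [set d | exists x : 'I_(\dim {:A}) -> A,
    (forall i, Lam (x i)) /\ d%:F = \det (\matrix_(i, j) tr (x i * x j))].

Definition ideal_inv_scale p Gam : set A :=
  [set x | exists s : seq ({fraction R} * A),
     (forall i, i \in s -> ideal_inv p i.1 /\ Gam i.2) /\
     x = \sum_(i <- s) i.1 *: i.2].

(* The states of the procedure are the pairs (T, S); one step processes an
   arbitrary element Gam of S. *)
Definition state : Type := (set (set A) * set (set A))%type.

Definition procedure_step p (st st' : state) : Prop :=
  exists2 Gam, st.2 Gam &
    let N := [set Gam' | minimal_overorder Gam Gam' /\
                         Gam' `<=` ideal_inv_scale p Gam] in
    st' = (st.1 `|` N, (st.2 `\ Gam) `|` N).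

Definition initial_state Lam : state := ([set Lam], [set Lam]).

(* There is no infinite run, whatever elements are chosen. *)
Definition procedure_terminates p Lam : Prop :=
  Acc (fun st' st => procedure_step p st st') (initial_state Lam).

Definition procedure_returns p Lam (T : set (set A)) : Prop :=
  clos_refl_trans _ (procedure_step p) (initial_state Lam) (T, set0).

(* The sum of the L i, with the convention that the empty sum is Lam. *)
Definition order_sum Lam (r : nat) (L : 'I_r -> set A) : set A :=
  if r == 0%N then Lam else
  [set x | exists y : 'I_r -> A, (forall i, L i (y i)) /\ x = \sum_i y i].

End Orders.

(* Main.v *)
Require Import Defs.
From HB Require Import structures.
From mathcomp Require Import all_boot all_order all_algebra all_field.
From mathcomp Require Import ring.
From mathcomp Require Import boolp classical_sets functions.
From Stdlib Require Import Relation_Operators.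

Set Implicit Arguments.
Unset Strict Implicit.
Unset Printing Implicit Defensive.

Import GRing.Theory.
Local Open Scope classical_set_scope.
Local Open Scope ring_scope.

(** The reduced trace of an element of an order is integral, hence in [R].  So
    all overorders of [Lam] lie in the dual lattice of [Lam], which has finite
    index over [Lam]: there are finitely many overorders, and the procedure
    terminates.  If [Gam'] is a minimal overorder of [Gam] and [Gam' / Gam] is
    p-primary, then Nakayama's lemma excludes [Gam + p Gam' = Gam'], so
    [p Gam'] is contained in [Gam]; hence the procedure climbs to every
    p-primary overorder.  By its structure as a torsion module, an overorder is
    the sum of its primary parts; and if the p-primary part is not [Lam], an
    element of it outside [Lam] can replace a member of any basis contained in
    [Lam], which divides the Gram determinant by the square of an element
    outside the local ring at p, so that [p ^ 2] divides the discriminant. *)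

(** No localisation is formed. An argument local at [p] is replaced by splitting 1 between two
    comaximal ideals, or by clearing a denominator outside [p]. The Dedekind hypotheses are
    noetherianity, integral closure and dimension at most one, so invertibility of ideals has to be
    derived; afterwards it is mostly used as an identity [1 = \sum u * v] with [u] in the inverse
    and [v] in the ideal.

    Index ideals are defined through a decomposition into cyclic modules. The proof works instead
    with [primary_overorder], a condition on single elements, and builds cyclic decompositions only
    for [p_overorderE].

    Every new order has to be shown finitely generated and projective; for a submodule with bounded
    denominators both follow from a dual basis.

    An order may re-enter the work set after having been processed, so the number of unprocessed
    orders need not decrease; termination rests on a weight that falls steeply as orders grow. *)

Section Fractions.
Variable R : idomainType.
Local Notation K := {fraction R}.
Implicit Types (x y : K).

Definition in_base x : Prop := exists r : R, x = r%:F.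

Lemma tofrac_inj : injective (@tofrac R).
Proof. by move=> x y /eqP; rewrite tofrac_eq => /eqP. Qed.

Lemma in_base_tofrac (r : R) : in_base r%:F. Proof. by exists r. Qed.

Lemma in_base0 : in_base 0. Proof. by exists 0; rewrite tofrac0. Qed.

Lemma in_base1 : in_base 1. Proof. by exists 1; rewrite tofrac1. Qed.

Lemma in_baseD x y : in_base x -> in_base y -> in_base (x + y).
Proof. by move=> [r ->] [s ->]; exists (r + s); rewrite tofracD. Qed.

Lemma in_baseN x : in_base x -> in_base (- x).
Proof. by move=> [r ->]; exists (- r); rewrite tofracN. Qed.

Lemma in_baseM x y : in_base x -> in_base y -> in_base (x * y).
Proof. by move=> [r ->] [s ->]; exists (r * s); rewrite tofracM. Qed.

Lemma in_base_sum (I : Type) (s : seq I) (P : pred I) (F : I -> K) :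
  (forall i, P i -> in_base (F i)) -> in_base (\sum_(i <- s | P i) F i).
Proof. by move=> h; elim/big_ind: _ => //; [exact: in_base0 | exact: in_baseD]. Qed.

Lemma in_base_mx m n (M : 'M[K]_(m, n)) :
  (forall i j, in_base (M i j)) -> exists N : 'M[R]_(m, n), M = map_mx (@tofrac R) N.
Proof.
move=> h; exists (\matrix_(i, j) projT1 (cid (h i j))).
by apply/matrixP => i j; rewrite !mxE; case: cid.
Qed.

Lemma in_base_det n (M : 'M[K]_n) : (forall i j, in_base (M i j)) -> in_base (\det M).
Proof. by move=> /in_base_mx[N ->]; exists (\det N); rewrite det_map_mx. Qed.

Lemma fraction_repr x : exists a b : R, b != 0 /\ x = a%:F / b%:F.
Proof.
elim/quotW: x => q; exists q.1, q.2; split; first exact: denom_ratioP.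
have q0 : q.2%:F != 0 :> K by rewrite tofrac_eq0 denom_ratioP.
apply: (mulIf q0); rewrite mulfVK // {q0}; unlock FracField.tofrac.
rewrite -[LHS]FracField.pi_mul /FracField.mulf.
apply/eqmodP => /=; rewrite FracField.equivfE !numden_Ratio ?mulf_neq0 ?oner_neq0 ?denom_ratioP //.
by rewrite !mulr1 mulrC.
Qed.

End Fractions.

(** * Ideals *)

Section IdealArithmetic.
Variable R : idomainType.
Local Notation K := {fraction R}.
Implicit Types (a b c p q : set R).

Lemma idealN a x : is_ideal a -> a x -> a (- x).
Proof. by move=> ha ax; rewrite -mulN1r; apply: idealM. Qed.

Lemma idealB a x y : is_ideal a -> a x -> a y -> a (x - y).
Proof. by move=> ha ax ay; apply: idealD => //; apply: idealN. Qed.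

Lemma idealM_right a x y : is_ideal a -> a x -> a (x * y).
Proof. by move=> ha ax; rewrite mulrC; apply: idealM. Qed.

Lemma ideal_sum a (I : eqType) (s : seq I) (F : I -> R) :
  is_ideal a -> (forall i, i \in s -> a (F i)) -> a (\sum_(i <- s) F i).
Proof.
move=> ha h; rewrite big_seq; elim/big_ind: _ => //; first exact: ideal0.
by move=> x y; apply: idealD.
Qed.

Lemma ideal_eqT a : is_ideal a -> a 1 -> a = setT.
Proof.
move=> ha a1; apply/seteqP; split=> // x _.
by rewrite -[x]mulr1; apply: idealM.
Qed.

Lemma ideal_neq0 a : is_ideal a -> a <> [set 0] -> exists2 x, a x & x != 0.
Proof.
move=> ha an0; apply: contrapT => h; apply: an0; apply/seteqP; split=> x /=.
  by move=> ax; apply: contrapT => x0; apply: h; exists x => //; apply/eqP.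
by move=> ->; apply: ideal0.
Qed.

Lemma nonzero_ideal a x : a x -> x != 0 -> a <> [set 0].
Proof. by move=> ax x0 e; move: ax x0; rewrite e /= => ->; rewrite eqxx. Qed.

Lemma idealT : is_ideal [set: R]. Proof. by []. Qed.

Lemma ideal_gen_ideal (S : set R) : is_ideal (ideal_gen S).
Proof.
split; first by exists [::]; rewrite big_nil.
  move=> _ _ [s [hs ->]] [t [ht ->]]; exists (s ++ t); rewrite big_cat; split=> // i.
  by rewrite mem_cat => /orP[/hs|/ht].
move=> r _ [s [hs ->]]; exists [seq (r * i.1, i.2) | i <- s]; split.
  by move=> _ /mapP[i /hs hi ->].
by rewrite big_map mulr_sumr; apply: eq_bigr => i _; rewrite mulrA.
Qed.

Lemma ideal_gen_subset (S : set R) : S `<=` ideal_gen S.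
Proof.
move=> x Sx; exists [:: (1, x)]; rewrite big_seq1 mul1r; split=> // i.
by rewrite inE => /eqP->.
Qed.

Lemma ideal_gen_min (S : set R) a : is_ideal a -> S `<=` a -> ideal_gen S `<=` a.
Proof.
move=> ha Sa _ [s [hs ->]]; apply: ideal_sum => // i /hs /Sa.
exact: idealM.
Qed.

Lemma ideal_mul_ideal a b : is_ideal (ideal_mul a b).
Proof. exact: ideal_gen_ideal. Qed.

Lemma mem_ideal_mul a b x y : a x -> b y -> ideal_mul a b (x * y).
Proof. by move=> ax bY; apply: ideal_gen_subset; exists x, y. Qed.

Lemma ideal_mul_min a b c : is_ideal c -> (forall x y, a x -> b y -> c (x * y)) ->
  ideal_mul a b `<=` c.
Proof. by move=> hc h; apply: ideal_gen_min => // _ [x [y [ax bY ->]]]; apply: h. Qed.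

Lemma ideal_mulSS a a' b b' : a `<=` a' -> b `<=` b' -> ideal_mul a b `<=` ideal_mul a' b'.
Proof.
move=> sa sb; apply: ideal_mul_min; first exact: ideal_mul_ideal.
by move=> x y /sa ax /sb bY; apply: mem_ideal_mul.
Qed.

Lemma ideal_mul_subl a b : is_ideal a -> ideal_mul a b `<=` a.
Proof. by move=> ha; apply: ideal_mul_min => // x y ax _; apply: idealM_right. Qed.

Lemma ideal_mul_subr a b : is_ideal b -> ideal_mul a b `<=` b.
Proof. by move=> hb; apply: ideal_mul_min => // x y _ bY; apply: idealM. Qed.

Lemma ideal_mulC a b : ideal_mul a b = ideal_mul b a.
Proof.
wlog suff h : a b / ideal_mul a b `<=` ideal_mul b a.
  by apply/seteqP; split; apply: h.
apply: ideal_mul_min => [|x y ax bY]; first exact: ideal_mul_ideal.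
by rewrite mulrC; apply: mem_ideal_mul.
Qed.

Lemma ideal_preim_mul c r : is_ideal c -> is_ideal [set x | c (x * r)].
Proof.
move=> hc; split=> /=; first by rewrite mul0r; apply: ideal0.
  by move=> x y; rewrite mulrDl; apply: idealD.
by move=> s x; rewrite -mulrA; apply: idealM.
Qed.

Lemma ideal_mulA_sub a b c : ideal_mul (ideal_mul a b) c `<=` ideal_mul a (ideal_mul b c).
Proof.
apply: ideal_mul_min; first exact: ideal_mul_ideal.
move=> x y abx cy; move: x abx; apply: ideal_mul_min.
  exact/ideal_preim_mul/ideal_mul_ideal.
by move=> u v au bv /=; rewrite -mulrA; do 2?apply: mem_ideal_mul.
Qed.

Lemma ideal_mulA a b c : ideal_mul a (ideal_mul b c) = ideal_mul (ideal_mul a b) c.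
Proof.
apply/seteqP; split; last exact: ideal_mulA_sub.
rewrite [X in X `<=` _]ideal_mulC [ideal_mul b c]ideal_mulC.
rewrite [ideal_mul (ideal_mul a b) c]ideal_mulC [ideal_mul a b]ideal_mulC.
exact: ideal_mulA_sub.
Qed.

Lemma ideal_mulT a : is_ideal a -> ideal_mul a setT = a.
Proof.
move=> ha; apply/seteqP; split; first exact: ideal_mul_subl.
by move=> x ax; rewrite -[x]mulr1; apply: mem_ideal_mul.
Qed.

Lemma ideal_Tmul a : is_ideal a -> ideal_mul setT a = a.
Proof. by move=> ha; rewrite ideal_mulC ideal_mulT. Qed.

Definition ideal_prod (s : seq (set R)) : set R := foldr (@ideal_mul R) setT s.

Lemma ideal_prod_ideal s : is_ideal (ideal_prod s).
Proof. by case: s => [|a s]; [exact: idealT | exact: ideal_mul_ideal]. Qed.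

Lemma ideal_expE p k : ideal_exp p k = ideal_prod (nseq k p).
Proof. by elim: k => //= k ->. Qed.

Lemma ideal_exp_ideal p k : is_ideal (ideal_exp p k).
Proof. by rewrite ideal_expE; apply: ideal_prod_ideal. Qed.

Lemma ideal_prod_cat s t :
  ideal_prod (s ++ t) = ideal_mul (ideal_prod s) (ideal_prod t).
Proof.
elim: s => [|a s IHs] /=; first by rewrite ideal_Tmul //; apply: ideal_prod_ideal.
by rewrite IHs ideal_mulA.
Qed.

Lemma ideal_expD p m n : ideal_exp p (m + n) = ideal_mul (ideal_exp p m) (ideal_exp p n).
Proof. by rewrite !ideal_expE nseqD ideal_prod_cat. Qed.

Lemma ideal_exp_le p m n : (m <= n)%N -> ideal_exp p n `<=` ideal_exp p m.
Proof.
move=> /subnKC <-; rewrite ideal_expD.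
by apply: ideal_mul_subl; apply: ideal_exp_ideal.
Qed.

(** Used to gather all factors equal to one prime in a product of primes. *)
Lemma ideal_prod_filter (P : pred (set R)) s :
  ideal_mul (ideal_prod (filter P s)) (ideal_prod (filter (predC P) s)) `<=` ideal_prod s.
Proof.
elim: s => [|a s IHs] /=; first by rewrite ideal_mulT.
case: (P a) => /=.
  by rewrite -ideal_mulA; apply: ideal_mulSS.
rewrite [X in X `<=` _]ideal_mulC -ideal_mulA [X in ideal_mul a X]ideal_mulC.
exact: ideal_mulSS.
Qed.

Lemma prime_ideal_prod p s : is_prime_ideal p -> ideal_prod s `<=` p ->
  exists2 q, q \in s & q `<=` p.
Proof.
case=> hp np1 pM; elim: s => [|q s IHs] /= sp; first by case: np1; apply: sp.
case: (pselect (q `<=` p)) => [qp|/existsNP[x /not_implyP[qx npx]]].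
  by exists q; rewrite ?mem_head.
have [|r rs rp] := IHs; last by exists r; rewrite // inE rs orbT.
by move=> y sy; have /pM[] := sp _ (mem_ideal_mul qx sy).
Qed.

Definition ideal_add a b : set R := [set z | exists x y, [/\ a x, b y & z = x + y]].

Lemma ideal_add_ideal a b : is_ideal a -> is_ideal b -> is_ideal (ideal_add a b).
Proof.
move=> ha hb; split; first by exists 0, 0; rewrite addr0; split=> //; apply: ideal0.
  move=> _ _ [x [y [ax bY ->]]] [x' [y' [ax' bY' ->]]]; exists (x + x'), (y + y').
  by split; [apply: idealD|apply: idealD|ring].
move=> r _ [x [y [ax bY ->]]]; exists (r * x), (r * y).
by split; [apply: idealM|apply: idealM|ring].
Qed.

Lemma ideal_add_subl a b : is_ideal b -> a `<=` ideal_add a b.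
Proof. by move=> hb x ax; exists x, 0; split; rewrite ?addr0 //; apply: ideal0. Qed.

Lemma ideal_add_subr a b : is_ideal a -> b `<=` ideal_add a b.
Proof. by move=> ha x ax; exists 0, x; split; rewrite ?add0r //; apply: ideal0. Qed.

Definition principal (r : R) : set R := [set x | exists s, x = s * r].

Lemma principal_ideal r : is_ideal (principal r).
Proof.
split; first by exists 0; rewrite mul0r.
  by move=> _ _ [s ->] [t ->]; exists (s + t); rewrite mulrDl.
by move=> t _ [s ->]; exists (t * s); rewrite mulrA.
Qed.

Lemma principal_id r : principal r r. Proof. by exists 1; rewrite mul1r. Qed.

Lemma maximal_prime p : is_maximal_ideal p -> is_prime_ideal p.
Proof.
case=> hp np1 pmax; split=> // x y pxy; apply: contrapT => /not_orP[npx npy].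
have hpx := ideal_add_ideal hp (principal_ideal x).
have [e|e] := pmax _ hpx (ideal_add_subl (principal_ideal x)).
  by apply: npx; rewrite -e; apply: ideal_add_subr => //; apply: principal_id.
have : ideal_add p (principal x) 1 by rewrite e.
case=> u [_ [pu [s ->] e1]]; apply: npy.
rewrite -[y]mul1r e1 mulrDl -mulrA; apply: idealD => //; first exact: idealM_right.
exact: idealM.
Qed.

(** Comaximality, with the splitting [1 = u + (1 - u)] as witness. *)
Definition coideal a b : Prop := exists2 u, a u & b (1 - u).

Lemma coidealC a b : coideal a b -> coideal b a.
Proof. by case=> u au bu; exists (1 - u) => //; rewrite subKr. Qed.

Lemma coideal_maximal a p : is_maximal_ideal p -> is_ideal a -> ~ a `<=` p -> coideal a p.
Proof.
case=> hp np1 pmax ha nap.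
have [e|e] := pmax _ (ideal_add_ideal hp ha) (ideal_add_subl ha).
  by case: nap; rewrite -[X in _ `<=` X]e; apply: ideal_add_subr.
have : ideal_add p a 1 by rewrite e.
by case=> u [v [pu av e1]]; exists v => //; rewrite e1 addrK.
Qed.

Lemma coideal_exp a p k : is_ideal a -> is_ideal p -> coideal a p -> coideal a (ideal_exp p k).
Proof.
move=> ha hp [u au pu]; elim: k => [|k [v av pv]]; first by exists u.
(* Chosen so that its complement to 1 is the product [(1 - u) * (1 - v)]. *)
exists (u + v - u * v); last first.
  have -> : 1 - (u + v - u * v) = (1 - u) * (1 - v) by ring.
  exact: mem_ideal_mul.
by apply: idealB => //; [apply: idealD|apply: idealM].
Qed.

Lemma coideal_expexp a b k l : is_ideal a -> is_ideal b -> coideal a b ->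
  coideal (ideal_exp a k) (ideal_exp b l).
Proof.
move=> ha hb hab; apply: coideal_exp => //; first exact: ideal_exp_ideal.
by apply: coidealC; apply: coideal_exp => //; apply: coidealC.
Qed.

End IdealArithmetic.

(** * Dedekind domains: prime ideals *)

Section Dedekind.
Variable R : idomainType.
Local Notation K := {fraction R}.
Implicit Types (a b c p q : set R).

(** For Zorn's lemma: generators of the union of a chain already lie in one member. [X0] serves the
    empty list. *)
Lemma chain_upper_bound (F : set (set R)) (X0 : set R) (s : seq R) :
  total_on F subset -> F X0 -> (forall x, x \in s -> (\bigcup_(X in F) X) x) ->
  exists2 X, F X & forall x, x \in s -> X x.
Proof.
move=> Ftot FX0; elim: s => [|x s IHs] h; first by exists X0.
have [|X FX sX] := IHs; first by move=> y ys; apply: h; rewrite inE ys orbT.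
have [Y FY Yx] := h x (mem_head _ _).
have [XY|YX] := Ftot _ _ FX FY.
  by exists Y => // y; rewrite inE => /predU1P[->|/sX/XY].
by exists X => // y; rewrite inE => /predU1P[->|/sX]; first exact: YX.
Qed.

(** The union of a non-empty chain of ideals is finitely generated, hence equal to a member of the
    chain, so Zorn's lemma applies. *)
Lemma noetherian_maximal (P : set (set R)) a0 :
  (forall a, is_ideal a -> exists s : seq R, a = ideal_gen [set` s]) ->
  (forall a, P a -> is_ideal a) -> P a0 ->
  exists m, P m /\ forall b, P b -> m `<=` b -> b = m.
Proof.
move=> noeth Pid Pa0.
(* The empty set is added because Zorn_bigcup also considers the empty chain. *)
pose Q : set (set R) := [set a | a = set0 \/ P a].
have [|m [Qm mmax]] := @Zorn_bigcup _ Q.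
  move=> F FQ Ftot.
  have [[X0 FX0 PX0]|noP] := pselect (exists2 X, F X & P X); last first.
    left; apply/seteqP; split=> // x [X FX Xx].
    by case: (FQ X FX) => [e|PX]; [rewrite e in Xx|apply: noP; exists X].
  set U := \bigcup_(X in F) X.
  have Uid : is_ideal U.
    split; first by exists X0 => //; apply: ideal0; apply: Pid.
      move=> x y Ux Uy.
      have [|X FX sX] := @chain_upper_bound F X0 [:: x; y] Ftot FX0.
        by move=> z; rewrite !inE => /orP[|] /eqP->.
      have Xx : X x by apply: sX; rewrite !inE eqxx.
      have Xy : X y by apply: sX; rewrite !inE eqxx orbT.
      exists X => //; case: (FQ X FX) => [e|/Pid hX]; first by rewrite e in Xx.
      exact: idealD.
    move=> r x [X FX Xx]; exists X => //.
    by case: (FQ X FX) => [e|/Pid hX]; [rewrite e in Xx|apply: idealM].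
  have [s Us] := noeth U Uid.
  have [|X FX sX] := @chain_upper_bound F X0 (0 :: s) Ftot FX0.
    move=> x; rewrite -/U inE => /predU1P[->|xs]; first exact: ideal0.
    by rewrite Us; apply: ideal_gen_subset.
  have X0' : X 0 by apply: sX; rewrite mem_head.
  right; suff -> : U = X by case: (FQ X FX) => // e; rewrite e in X0'.
  apply/seteqP; split; last by move=> x Xx; exists X.
  case: (FQ X FX) => [e|/Pid hX]; first by rewrite e in X0'.
  by rewrite Us; apply: ideal_gen_min => // x /= xs; apply: sX; rewrite inE xs orbT.
have nm0 : m <> set0.
  move=> e; apply: (mmax a0); last by right.
  by split=> [x|sub]; [rewrite e|have := sub _ (ideal0 (Pid _ Pa0)); rewrite e].
have Pm : P m by case: Qm.
exists m; split=> // b Pb mb; apply/seteqP; split=> //.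
by apply: contrapT => nbm; apply: (mmax b); [split|right].
Qed.

Variable R_dedekind : is_dedekind R.
Let noeth := dedekind_noetherian R_dedekind.

Definition nonzero_prime p : Prop := is_prime_ideal p /\ p <> [set 0].

Lemma nonzero_prime_maximal p : nonzero_prime p -> is_maximal_ideal p.
Proof. by case=> hp hp0; apply: dedekind_dim_le1. Qed.

Lemma exists_maximal_ideal a : is_ideal a -> ~ a 1 ->
  exists2 p, is_maximal_ideal p & a `<=` p.
Proof.
move=> ha na1.
have [||p [[hp np1 ap] pmax]] :=
    @noetherian_maximal [set b | [/\ is_ideal b, ~ b 1 & a `<=` b]] a noeth.
- by move=> b [].
- by split=> //; exact: subset_refl.
exists p => //; split=> // b hb pb.
have [b1|nb1] := pselect (b 1); first by right; apply: ideal_eqT.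
by left; apply: pmax => //; split=> //; apply: subset_trans pb.
Qed.

(** A maximal counterexample [m] is not prime: there is [x * y] in [m] with [x], [y] outside. The
    larger ideals [m + (x)] and [m + (y)] contain products of primes, and their own product lies in
    [m]. *)
Lemma nonzero_ideal_contains_prime_prod a : is_ideal a -> a <> [set 0] ->
  exists2 s : seq (set R), (forall q, q \in s -> nonzero_prime q) & ideal_prod s `<=` a.
Proof.
move=> ha an0; apply: contrapT => na.
have [||m [[hm mn0 nm] mmax]] := @noetherian_maximal
  [set b | [/\ is_ideal b, b <> [set 0] & ~ exists2 s : seq (set R),
     (forall q, q \in s -> nonzero_prime q) & ideal_prod s `<=` b]] a noeth.
- by move=> b [].
- by split.
have [x0 mx0 x0n0] := ideal_neq0 hm mn0.
have big x : ~ m x -> exists2 s : seq (set R),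
    (forall q, q \in s -> nonzero_prime q) & ideal_prod s `<=` ideal_add m (principal x).
  move=> nmx; apply: contrapT => h; apply: nmx.
  rewrite -(mmax (ideal_add m (principal x))).
  - by apply: ideal_add_subr => //; apply: principal_id.
  - split=> //; first exact/ideal_add_ideal/principal_ideal.
    by apply: (nonzero_ideal (x := x0)) => //; apply/(ideal_add_subl (principal_ideal x)).
  - exact/ideal_add_subl/principal_ideal.
apply: nm; have [m1|nm1] := pselect (m 1).
  by exists [::] => // x _; rewrite (ideal_eqT hm).
have [pm|npm] := pselect (is_prime_ideal m).
  exists [:: m]; last by rewrite /= ideal_mulT.
  by move=> q; rewrite inE => /eqP->; split.
have [x [y [mxy nmx nmy]]] : exists x y, [/\ m (x * y), ~ m x & ~ m y].
  apply: contrapT => h; apply: npm; split=> // x y mxy.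
  by apply: contrapT => /not_orP[? ?]; apply: h; exists x, y.
have [s hs sx] := big x nmx; have [t ht ty] := big y nmy.
exists (s ++ t); first by move=> q; rewrite mem_cat => /orP[/hs|/ht].
rewrite ideal_prod_cat; apply: ideal_mul_min => // u v /sx[u1 [_ [mu1 [r ->] ->]]].
move=> /ty[v1 [_ [mv1 [r' ->] ->]]].
have -> : (u1 + r * x) * (v1 + r' * y) =
    (v1 + r' * y) * u1 + (r * x * v1 + r * r' * (x * y)) by ring.
by do !apply: idealD => //; apply: idealM.
Qed.

Lemma ideal_inv1 a : ideal_inv a 1.
Proof. by move=> r _; exists r; rewrite mul1r. Qed.

(** For [x] in [p], take a shortest product of primes inside [(x)]. One factor lies in [p], hence
    equals [p] by maximality. The product of the others has an element [b] outside [(x)], and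
    [b / x] is the element sought. *)
Lemma prime_inv_not_integral p : nonzero_prime p -> exists2 x, ideal_inv p x & ~ in_base x.
Proof.
move=> pp; have [[hp np1 pM] pn0] := pp.
have [x px x0] := ideal_neq0 hp pn0.
have [|s hs sx] := nonzero_ideal_contains_prime_prod (principal_ideal x).
  exact: (nonzero_ideal (principal_id x)).
suff [b nb bp] : exists2 b, ~ principal x b & forall y, p y -> principal x (b * y).
  have xF0 : x%:F != 0 :> K by rewrite tofrac_eq0.
  exists (b%:F / x%:F).
    move=> y /bp[t e]; exists t.
    by rewrite mulrAC -tofracM e tofracM mulfK.
  move=> [t e]; apply: nb; exists t; apply: tofrac_inj.
  by rewrite tofracM -e mulfVK.
move: {2}(size s) (leqnn (size s)) => n; elim: n => [|n IHn] in s hs sx *.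
  rewrite leqn0 size_eq0 => /eqP s0; case: np1.
  have [t ->] : principal x 1 by apply: sx; rewrite s0.
  exact: idealM.
move=> ssz; have [|q qs qp] := @prime_ideal_prod _ p s pp.1.
  by apply: subset_trans sx _ => _ [t ->]; apply: idealM.
have eqp : p = q.
  have [_ _ qmax] := nonzero_prime_maximal (hs q qs).
  by have [//|pT] := qmax p hp qp; case: np1; rewrite pT.
move: hs sx ssz; case/splitPr: qs => s1 s2 hs sx ssz.
have [sub|/existsNP[b /not_implyP[bs nb]]] :=
  pselect (ideal_prod (s1 ++ s2) `<=` principal x).
  apply: IHn sub _ => [r|].
    by rewrite mem_cat => /orP[] h; apply: hs; rewrite mem_cat inE h ?orbT.
  by move: ssz; rewrite !size_cat /= addnS ltnS.
exists b => // y py; apply: sx.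
rewrite ideal_prod_cat /= ideal_mulA [ideal_mul _ q]ideal_mulC -ideal_mulA -ideal_prod_cat.
by rewrite mulrC -eqp; apply: mem_ideal_mul.
Qed.

End Dedekind.

(** * Invertibility of ideals *)

(** If [M] describes multiplication by [x] on the family [g], a polynomial in [x] acts through the
    same polynomial in [M]. Centrality of the scalars lets [x] pass the coefficients; [g] need not
    be free. *)
Lemma horner_stable_family (R : comNzRingType) (B : nzRingType) (h : {rmorphism R -> B})
    (x : B) n (g : 'I_n.+1 -> B) (M : 'M[R]_n.+1) (p : {poly R}) :
  (forall r b, h r * b = b * h r) ->
  (forall i, x * g i = \sum_j h (M i j) * g j) ->
  forall i, (map_poly h p).[x] * g i = \sum_j h (horner_mx M p i j) * g j.
Proof.
move=> hC xg; elim/poly_ind: p => [|p c IHp] i.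
  rewrite !rmorph0 horner0 mul0r big1 // => j _.
  by rewrite mxE rmorph0 mul0r.
rewrite rmorphD rmorphM /= map_polyX map_polyC /= hornerMXaddC mulrDl -mulrA xg.
rewrite [p * 'X]mulrC [horner_mx M _]rmorphD rmorphM /= horner_mx_X horner_mx_C.
under [RHS]eq_bigr => j _ do rewrite !mxE rmorphD mulrDl rmorph_sum mulr_suml.
rewrite big_split /=; congr (_ + _).
  rewrite mulr_sumr exchange_big /=; apply: eq_bigr => j _.
  rewrite mulrA -hC -mulrA IHp mulr_sumr; apply: eq_bigr => k _.
  by rewrite rmorphM mulrA.
rewrite (bigD1 i) //= eqxx mulr1n big1 ?addr0 // => j; rewrite eq_sym => /negPf->.
by rewrite mulr0n rmorph0 mul0r.
Qed.

(** The determinant trick, by Cayley-Hamilton. *)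
Lemma char_poly_stable_family (R : comNzRingType) (B : nzRingType) (h : {rmorphism R -> B})
    (x : B) n (g : 'I_n -> B) (M : 'M[R]_n) :
  (forall r b, h r * b = b * h r) ->
  (forall i, x * g i = \sum_j h (M i j) * g j) ->
  forall i, (map_poly h (char_poly M)).[x] * g i = 0.
Proof.
move=> hC; case: n => [|n] in g M *; first by move=> _ [].
move=> xg i; rewrite (horner_stable_family _ hC xg) Cayley_Hamilton big1 // => j _.
by rewrite mxE rmorph0 mul0r.
Qed.

(** The action is abstract so that the lemma serves both ideals of [R] and [R]-submodules of [A].
    Using [index] sends all occurrences of a repeated vector to its first position. *)
Lemma collect_combination (S V : nmodType) (act : S -> V -> V) (s : seq V) (t : seq (S * V)) :
  (forall v, act 0 v = 0) -> (forall a b v, act (a + b) v = act a v + act b v) ->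
  (forall i, i \in t -> i.2 \in s) ->
  exists c : 'I_(size s) -> S, \sum_(i <- t) act i.1 i.2 = \sum_j act (c j) s`_j.
Proof.
move=> act0 actD; elim: t => [|[r u] t IHt] ht.
  by exists (fun=> 0); rewrite big_nil big1.
have [|c ec] := IHt; first by move=> i it; apply: ht; rewrite inE it orbT.
have /= us : u \in s by have := ht (r, u) (mem_head _ _).
have us' : (index u s < size s)%N by rewrite index_mem.
exists (fun j => c j + (if j == Ordinal us' then r else 0)).
rewrite big_cons ec addrC /=.
under [RHS]eq_bigr => j _ do rewrite actD.
rewrite big_split /=; congr (_ + _).
by rewrite (bigD1 (Ordinal us')) //= eqxx nth_index // big1 ?addr0 // => j /negPf->.
Qed.

Section InvertibleIdeals.
Variable R : idomainType.
Local Notation K := {fraction R}.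
Implicit Types (a b c p q : set R).

(** By the determinant trick on generators of [a], a monic polynomial evaluated at [x] kills a
    non-zero generator, hence vanishes; then [R] is integrally closed. *)
Lemma stable_ideal_integral a (x : K) : is_dedekind R -> is_ideal a -> a <> [set 0] ->
  (forall r, a r -> exists2 s, a s & x * r%:F = s%:F) -> in_base x.
Proof.
move=> Rd ha an0 xa; have [s sa] := dedekind_noetherian Rd ha.
have as_ i : (i < size s)%N -> a s`_i by move=> ?; rewrite sa; apply/ideal_gen_subset/mem_nth.
have gen_combo y : a y -> exists c : 'I_(size s) -> R, y = \sum_j c j * s`_j.
  rewrite sa => -[t [ht ->]].
  by apply: (@collect_combination R R *%R) ht => [v|r u v]; rewrite ?mul0r ?mulrDl.
have combo (i : 'I_(size s)) : exists c : 'I_(size s) -> R,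
    x * (s`_i)%:F = \sum_j (c j)%:F * (s`_j)%:F.
  have [y /gen_combo[c ->] ->] := xa _ (as_ _ (ltn_ord i)).
  by exists c; rewrite rmorph_sum; apply: eq_bigr => j _; rewrite -tofracM.
pose M := \matrix_(i, j) projT1 (cid (combo i)) j.
have xM (i : 'I_(size s)) : x * (s`_i)%:F = \sum_j (M i j)%:F * (s`_j)%:F.
  rewrite [LHS](projT2 (cid (combo i))).
  by apply: eq_bigr => j _; rewrite mxE.
have [r r0 rn0] := ideal_neq0 ha an0.
have [i si0] : exists i : 'I_(size s), s`_i != 0.
  apply: contrapT => h; case/eqP: rn0; have [c ->] := gen_combo r r0.
  rewrite big1 // => i _; have [->|si] := eqVneq s`_i 0; first by rewrite mulr0.
  by case: h; exists i.
apply: (dedekind_integrally_closed Rd); exists (char_poly M); first exact: char_poly_monic.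
have /eqP := @char_poly_stable_family _ K (@tofrac R) x _
  (fun j : 'I_(size s) => (s`_j)%:F) M (fun r y => mulrC _ _) xM i.
by rewrite mulf_eq0 tofrac_eq0 (negPf si0) orbF.
Qed.

Hypothesis R_dedekind : is_dedekind R.

(* If [b = a a^-1] lies in a prime [p], then [p^-1] stabilises [a^-1], so its
   elements are integral, which is false. *)
Lemma ideal_invertible a : is_ideal a -> a <> [set 0] ->
  exists s : seq (K * R), (forall i, i \in s -> ideal_inv a i.1 /\ a i.2) /\
    \sum_(i <- s) i.1 * i.2%:F = 1.
Proof.
move=> ha an0.
pose b : set R := [set y | exists s : seq (K * R),
  (forall i, i \in s -> ideal_inv a i.1 /\ a i.2) /\ y%:F = \sum_(i <- s) i.1 * i.2%:F].
have bid : is_ideal b.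
  split; first by exists [::]; rewrite big_nil tofrac0.
    move=> x y [s [hs es]] [t [ht et]]; exists (s ++ t).
    rewrite tofracD es et big_cat; split=> // i.
    by rewrite mem_cat => /orP[/hs|/ht].
  move=> r y [s [hs es]]; exists [seq (i.1, r * i.2) | i <- s]; split.
    by move=> _ /mapP[i /hs[? ?] ->]; split=> //; apply: idealM.
  rewrite big_map tofracM es mulr_sumr; apply: eq_bigr => i _.
  by rewrite /= tofracM mulrCA.
have mem_b u v y : ideal_inv a u -> a v -> u * v%:F = y%:F -> b y.
  move=> au av e; exists [:: (u, v)]; rewrite big_seq1 e; split=> // i.
  by rewrite inE => /eqP->.
have [[s [hs es]]|nb1] := pselect (b 1); first by exists s; rewrite -es tofrac1.
have [p pmax bp] := exists_maximal_ideal R_dedekind bid nb1.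
have [r ar rn0] := ideal_neq0 ha an0.
have br : b r by apply: (mem_b 1 r) => //; [exact: ideal_inv1|rewrite mul1r].
have [|x px nx] := @prime_inv_not_integral _ R_dedekind p.
  split; first exact: maximal_prime.
  by apply: (nonzero_ideal (x := r)) => //; apply: bp.
have xinv y : ideal_inv a y -> ideal_inv a (x * y).
  move=> ay u au; have [t e] := ay u au.
  have [w ew] := px t (bp _ (mem_b _ _ _ ay au e)).
  by exists w; rewrite -mulrA e.
(* [J] is [r a^-1]: the factor [r] in [a] moves the fractional ideal into [R], where stability under
   [x] forces integrality. *)
case: nx; pose J : set R := [set j | exists2 y, ideal_inv a y & j%:F = r%:F * y].
apply: (@stable_ideal_integral J) => //.
- split.
  + by exists 0; [move=> t _; exists 0; rewrite mul0r tofrac0|rewrite mulr0 tofrac0].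
  + move=> j1 j2 [y ay ey] [z az ez]; exists (y + z); last by rewrite tofracD ey ez mulrDr.
    move=> t at_; have [u eu] := ay t at_; have [v ev] := az t at_.
    by exists (u + v); rewrite mulrDl eu ev tofracD.
  + move=> t j1 [y ay ey]; exists (t%:F * y); last by rewrite tofracM ey mulrCA.
    move=> u au; have [v ev] := ay u au.
    by exists (t * v); rewrite -mulrA ev tofracM.
- apply: (nonzero_ideal (x := r)) => //; exists 1; first exact: ideal_inv1.
  by rewrite mulr1.
move=> j [y ay ej]; have axy := xinv y ay; have [s es] := axy r ar.
exists s; last by rewrite -es ej; ring.
by exists (x * y) => //; rewrite -es; ring.
Qed.

Definition ideal_quotient a b : set R := [set r | forall y, b y -> a (r * y)].

Lemma ideal_quotient_ideal a b : is_ideal a -> is_ideal (ideal_quotient a b).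
Proof.
move=> ha; split=> /=; first by move=> y _; rewrite mul0r; apply: ideal0.
  by move=> x y hx hy z bz; rewrite mulrDl; apply: idealD; [|apply: hx|apply: hy].
by move=> r x hx z bz; rewrite -mulrA; apply: idealM => //; apply: hx.
Qed.

(** To contain is to divide: the quotient is [a b^-1]. With [1 = \sum u * v], an [x] in [a] is
    [\sum v * (u * x)], and each [u * x] lies in the quotient. *)
Lemma ideal_mul_quotient a b : is_ideal a -> is_ideal b -> b <> [set 0] ->
  a `<=` b -> ideal_mul b (ideal_quotient a b) = a.
Proof.
move=> ha hb bn0 ab.
apply/esym; apply/seteqP; split; last first.
  by apply: ideal_mul_min => // x y bx /= hy; rewrite mulrC; apply: hy.
move=> x ax; have [s [hs es]] := ideal_invertible hb bn0.
have sx i : exists t, i \in s -> i.1 * x%:F = t%:F.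
  have [/hs[bi _]|_] := boolP (i \in s); last by exists 0.
  by have [t e] := bi x (ab _ ax); exists t.
pose f i := projT1 (cid (sx i)).
have fE i : i \in s -> i.1 * x%:F = (f i)%:F by rewrite /f; case: cid.
have -> : x = \sum_(i <- s) i.2 * f i.
  apply: tofrac_inj; rewrite -[LHS]mul1r -es mulr_suml rmorph_sum big_seq [RHS]big_seq.
  by apply: eq_bigr => i si; rewrite /= tofracM -fE //; ring.
apply: ideal_sum => [|i si]; first exact: ideal_mul_ideal.
have [bi1 bi2] := hs i si.
apply: mem_ideal_mul => // y bY; have [t et] := bi1 y bY.
have -> : f i * y = t * x; last exact: idealM.
by apply: tofrac_inj; rewrite !tofracM -et -fE //; ring.
Qed.

Lemma ideal_divides_subset a b : is_ideal a -> is_ideal b -> b <> [set 0] ->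
  a `<=` b -> ideal_divides b a.
Proof.
move=> ha hb bn0 ab; exists (ideal_quotient a b); first exact: ideal_quotient_ideal.
by rewrite ideal_mul_quotient.
Qed.

(** If [a] is not inside [p], it is comaximal with the power of [p] it contains and equals [R].
    Otherwise divide by [p] and lower the exponent. *)
Lemma ideal_contains_exp a p k : is_maximal_ideal p -> p <> [set 0] -> is_ideal a ->
  ideal_exp p k `<=` a -> exists2 j, (j <= k)%N & a = ideal_exp p j.
Proof.
move=> pmax pn0; have [hp np1 _] := pmax.
elim: k a => [|k IHk] a ha pa.
  by exists 0%N => //; apply: ideal_eqT => //; apply: pa.
have [ap|nap] := pselect (a `<=` p); last first.
  exists 0%N => //; apply: ideal_eqT => //.
  have [u au /pa au1] := coideal_exp k.+1 ha hp (coideal_maximal pmax ha nap).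
  by rewrite -(subrK u 1); apply: idealD.
have [|j jk ej] := IHk (ideal_quotient a p) (ideal_quotient_ideal _ ha).
  by move=> x px y py; apply: pa; rewrite mulrC; apply: mem_ideal_mul.
by exists j.+1; rewrite // -(ideal_mul_quotient ha hp pn0 ap) ej.
Qed.

End InvertibleIdeals.

(** * Integrality of the reduced trace *)

Lemma irreducible_factor (F : fieldType) (q : {poly F}) : (1 < size q)%N ->
  exists2 p, irreducible_poly p & p %| q.
Proof.
move: {2}(size q) (leqnn (size q)) => n; elim: n => [|n IHn] in q *.
  by rewrite leqn0 => /eqP->.
move=> qn q1; have [irr|] := pselect (irreducible_poly q).
  by exists q => //; apply: dvdpp.
move=> /not_andP[//|/existsNP[p /not_implyP[p1 /not_implyP[pq npq]]]].
have q0 : q != 0 by rewrite -size_poly_gt0 ltnW.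
have p0 : p != 0 by apply: contraTneq pq => ->; rewrite dvd0p.
have pltq : (size p < size q)%N.
  by rewrite ltn_neqAle dvdp_leq // andbT dvdp_size_eqp //; apply/negP.
have [|r irr rp] := IHn p (leq_trans pltq qn) _.
  by rewrite ltn_neqAle eq_sym p1 size_poly_gt0.
by exists r => //; apply: dvdp_trans pq.
Qed.

(** One root is adjoined at a time; the base field is generalised in the induction, which continues
    over the extension. The list [rs] keeps multiplicities. *)
Lemma monic_splits_in_extension (F : fieldType) (q : {poly F}) : q \is monic ->
  exists (L : fieldType) (j : {rmorphism F -> L}) (rs : seq L),
    map_poly j q = \prod_(r <- rs) ('X - r%:P).
Proof.
move: {2}(size q) (leqnn (size q)) => n; elim: n => [|n IHn] in F q *.
  by rewrite leqn0 size_poly_eq0 => /eqP-> /monicP; rewrite lead_coef0 => /eqP; rewrite eq_sym oner_eq0.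
move=> qn qmonic; have [q1|q1] := leqP (size q) 1.
  exists F, idfun, [::]; rewrite big_nil map_poly_id //.
  have /size_poly1P[c c0 e] : size q == 1%N.
    by rewrite eqn_leq q1 size_poly_gt0 monic_neq0.
  by move: qmonic; rewrite e monicE lead_coefC => /eqP->.
have [p irr pq] := irreducible_factor q1.
have [L _ [z rz _]] := irredp_FAdjoin irr.
have : root (map_poly (in_alg L) q) z.
  by apply: root_dvdp rz; rewrite ?dvdp_map.
case/factor_theorem => q' eq'.
have q'monic : q' \is monic.
  by rewrite -(monicMr q' (monicXsubC z)) -eq' map_monic.
have [|L' [j [rs ers]]] := IHn _ q' _ q'monic.
  rewrite -ltnS; apply: leq_trans qn.
  rewrite -(size_map_poly (in_alg L) q) eq' size_Mmonic ?monic_neq0 ?monicXsubC //.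
  by rewrite size_XsubC addn2.
exists L', (j \o in_alg L), (j z :: rs).
rewrite map_poly_comp eq' rmorphM /= ers big_cons mulrC; congr (_ * _).
by rewrite rmorphB /= map_polyX map_polyC.
Qed.

Lemma integral_sum (S T : comNzRingType) (h : {rmorphism S -> T}) (I : eqType)
    (s : seq I) (F : I -> T) :
  (forall i, i \in s -> integralOver h (F i)) -> integralOver h (\sum_(i <- s) F i).
Proof.
move=> hF; rewrite big_seq; elim/big_ind: _ => //; first exact: integral0.
by move=> x y; apply: integral_add.
Qed.

(* The trace is a sum of roots of the characteristic polynomial, taken in a
   splitting field, and these are among the roots of [f]. *)
Lemma integral_mxtrace (S : comNzRingType) (E : fieldType) (h : {rmorphism S -> E}) n
    (M : 'M[E]_n.+1) (f : {poly S}) :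
  f \is monic -> horner_mx M (map_poly h f) = 0 -> integralOver h (\tr M).
Proof.
move=> fmonic fM.
have [L [j [rs ers]]] := monic_splits_in_extension (char_poly_monic M).
rewrite map_char_poly in ers.
have size_rs : size rs = n.+1.
  by have := size_char_poly (map_mx j M); rewrite ers size_prod_XsubC => -[].
have jtr : j (\tr M) = \sum_(r <- rs) r.
  apply: oppr_inj; rewrite -coefPn_prod_XsubC ?size_rs // -ers char_poly_trace //.
  by rewrite trace_map_mx.
have [g gmonic] : integralOver (j \o h) (j (\tr M)).
  rewrite jtr; apply: integral_sum => r rrs; exists f => //.
  have : root (char_poly (map_mx j M)) r by rewrite ers root_prod_XsubC.
  rewrite -root_mxminpoly map_poly_comp; apply: root_dvdp.
  by apply: mxminpoly_min; rewrite -map_horner_mx fM map_mx0.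
by rewrite map_poly_comp fmorph_root => rg; exists g.
Qed.

Lemma in_alg_comm (K : fieldType) (A : falgType K) (c : K) (x : A) :
  in_alg A c * x = x * in_alg A c.
Proof. by rewrite !in_algE mulr_algl mulr_algr. Qed.

(** The sum is the trace of the matrix of multiplication by [z] on the span of [b], and freeness
    makes [f] kill that matrix. Only [f] of [z] times each [b_i] is asked to vanish, because in a
    component [f] of [z] vanishes only after multiplication by the unit of that component. *)
Lemma integral_mul_trace (S : comNzRingType) (K : fieldType) (A : falgType K)
    (h : {rmorphism S -> K}) n (b : n.-tuple A) (z : A) (f : {poly S}) :
  f \is monic -> free b -> (forall i : 'I_n, z * b`_i \in <<b>>%VS) ->
  (forall i : 'I_n, (map_poly (in_alg A) (map_poly h f)).[z] * b`_i = 0) ->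
  integralOver h (\sum_(i < n) coord b i (z * b`_i)).
Proof.
move=> fmonic; case: n => [|n] in b * => bfree zb fz.
  by rewrite big_ord0; apply: integral0.
pose M := \matrix_(i, j < n.+1) coord b j (z * b`_i).
have -> : \sum_(i < n.+1) coord b i (z * b`_i) = \tr M.
  by apply: eq_bigr => i _; rewrite mxE.
apply: (integral_mxtrace fmonic); apply/matrixP => i j; rewrite [RHS]mxE.
have zM (k : 'I_n.+1) : z * b`_k = \sum_(l < n.+1) in_alg A (M k l) * b`_l.
  rewrite [LHS](coord_span (zb k)); apply: eq_bigr => l _.
  by rewrite mxE mulr_algl.
have := @horner_stable_family K A (in_alg A) z n (fun k => b`_k) M (map_poly h f)
  (@in_alg_comm _ _) zM i.
rewrite fz => e; apply: (freeP bfree) j.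
by rewrite [RHS]e; apply: eq_bigr => l _; rewrite mulr_algl.
Qed.

(** * Reduced trace of a simple component *)

Section CentralTrace.
Variables (K : fieldType) (A : falgType K) (I : {vspace A}) (e : A).
Variables (E : fieldType) (n : nat) (sigma : A -> E) (phi : A -> 'M[E]_n.+1) (t : A -> A).
Hypotheses (I_simple : simple_component I) (eI : e \in I).
Hypotheses (mul_e : forall x, x \in I -> e * x = x) (mule : forall x, x \in I -> x * e = x).
Hypothesis I_split : splitting I sigma phi.
Hypothesis t_trace : {in I, forall x, t x \in 'Z(I)%VS /\ sigma (t x) = \tr (phi x)}.

Lemma component_mull a x : x \in I -> a * x \in I.
Proof. by case: I_simple => -[/prodvP h _] _ _ xI; apply: h => //; apply: memvf. Qed.

Lemma component_mulr a x : x \in I -> x * a \in I.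
Proof. by case: I_simple => -[_ /prodvP h] _ _ xI; apply: h => //; apply: memvf. Qed.

Lemma mem_component_center z : z \in 'Z(I)%VS <->
  z \in I /\ {in I, forall x, z * x = x * z}.
Proof.
rewrite /center_vspace; split; first by case/memv_capP=> ? /centvP.
by case=> zI zC; apply/memv_capP; split=> //; apply/centvP.
Qed.

Lemma component_center_sub z : z \in 'Z(I)%VS -> z \in I.
Proof. by case/mem_component_center. Qed.

Lemma component_center_unit : e \in 'Z(I)%VS.
Proof.
by apply/mem_component_center; split=> // x xI; rewrite mul_e ?mule.
Qed.

Lemma component_center_mul y z : y \in 'Z(I)%VS -> z \in 'Z(I)%VS -> y * z \in 'Z(I)%VS.
Proof.
case/mem_component_center => yI yC /mem_component_center[zI zC].
apply/mem_component_center; split=> [|x xI]; first exact: component_mull.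
by rewrite -mulrA zC // mulrA yC // mulrA.
Qed.

Lemma scalar_mx_inj : injective (@scalar_mx E n.+1).
Proof. by move=> a b /matrixP/(_ ord0 ord0); rewrite !mxE !mulr1n. Qed.

Let phiD : {in I &, {morph phi : x y / x + y}}. Proof. by case: I_split. Qed.
Let phiM : {in I &, forall x y, phi (x * y) = phi x *m phi y}. Proof. by case: I_split. Qed.
Let phiZ : {in 'Z(I)%VS, forall z, phi z = (sigma z)%:M}. Proof. by case: I_split. Qed.

Lemma splitting0 : phi 0 = 0.
Proof.
have := phiD (mem0v I) (mem0v I); rewrite addr0 => /eqP.
by rewrite -subr_eq0 opprD addrA subrr sub0r oppr_eq0 => /eqP.
Qed.

(** As [phi e] is a scalar idempotent, [sigma e] is 0 or 1. If it were 0, [phi] would vanish on [I],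
    although values of [phi] span the non-zero space of matrices. *)
Lemma splitting_unit : phi e = 1%:M.
Proof.
rewrite phiZ ?component_center_unit //; congr (_%:M).
have eZ := component_center_unit.
have : phi e = phi e *m phi e by rewrite -phiM // mul_e.
rewrite phiZ // -scalar_mxM => /scalar_mx_inj/eqP.
rewrite -subr_eq0 -{1}[sigma e]mulr1 -mulrBr mulf_eq0 subr_eq0.
case/orP=> [/eqP s0|/eqP//].
case: I_split => _ _ _ [m [b [bI _ /andP[/eqP span_b _]]]].
have phi0 x : x \in I -> phi x = 0.
  by move=> xI; rewrite -(mul_e xI) phiM // phiZ // s0 raddf0 mul0mx.
have /vlineP[c] : (1%:M : 'M[E]_n.+1) \in <[0]>%VS.
  have : <<[seq phi (b j) | j <- enum 'I_m]>>%VS = fullv by [].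
  suff: (<<[seq phi (b j) | j <- enum 'I_m]>> <= <[0]>)%VS.
    by move=> /subvP sub ef; apply: sub; rewrite ef memvf.
  apply/span_subvP => _ /mapP[j _ ->]; rewrite phi0 ?bI //; exact: memv_line.
rewrite scaler0 => /matrixP/(_ ord0 ord0); rewrite !mxE eqxx => /eqP.
by rewrite oner_eq0.
Qed.

Lemma sigmaD y z : y \in 'Z(I)%VS -> z \in 'Z(I)%VS -> sigma (y + z) = sigma y + sigma z.
Proof.
move=> yZ zZ; apply: scalar_mx_inj; rewrite rmorphD /= -!phiZ ?memvD //.
by rewrite phiD ?component_center_sub.
Qed.

Lemma sigmaM y z : y \in 'Z(I)%VS -> z \in 'Z(I)%VS -> sigma (y * z) = sigma y * sigma z.
Proof.
move=> yZ zZ; apply: scalar_mx_inj; rewrite scalar_mxM -!phiZ ?component_center_mul //.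
by rewrite phiM ?component_center_sub.
Qed.

Lemma sigma_unit : sigma e = 1.
Proof. by apply: scalar_mx_inj; rewrite -phiZ ?component_center_unit ?splitting_unit. Qed.

(** If [z] is not zero, the two-sided ideal [I z] is all of [I] by simplicity, so [e = x * z] for
    some [x]; applying [phi] gives [1 = 0]. *)
Lemma sigma_eq0 z : z \in 'Z(I)%VS -> sigma z = 0 -> z = 0.
Proof.
move=> zZ sz0; have /mem_component_center[zI zC] := zZ.
have [_ _ Imin] := I_simple.
have zJ x : x \in I -> x * z \in (amulr z @: I)%VS.
  by move=> xI; have -> : x * z = amulr z x; [rewrite lfunE|rewrite memv_img].
have imJ u : u \in (amulr z @: I)%VS -> exists2 x, x \in I & u = x * z.
  by case/memv_imgP => x xI ->; exists x; rewrite // lfunE.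
have [||J0|JI] := Imin (amulr z @: I)%VS.
- split; apply/prodvP => u v; last first.
    move=> /imJ[x xI ->] _.
  (* [z] is only known to commute with [I]; [v] may lie outside, but [e * v] does not. *)
  have -> : x * z * v = x * (e * v) * z.
    by rewrite -{1}(mule zI) -[RHS]mulrA -zC ?component_mulr // !mulrA.
  by apply: zJ; apply: component_mulr.
  by move=> _ /imJ[x xI ->]; rewrite mulrA; apply: zJ; apply: component_mull.
- by apply/subvP => u /imJ[x xI ->]; apply: component_mulr.
- by have := zJ e eI; rewrite J0 memv0 mul_e // => /eqP.
have : e \in (amulr z @: I)%VS by rewrite JI.
case/imJ => x xI ex; have := splitting_unit.
rewrite ex phiM // (phiZ zZ) sz0 raddf0 mulmx0 => /esym/eqP.
by rewrite oner_eq0.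
Qed.

(** Makes [E] an extension of [K], so that integrality over [S] can be tested in [E]. *)
Lemma base_embedding : exists iota : {rmorphism K -> E}, forall c, iota c = sigma (c *: e).
Proof.
have cZ c : c *: e \in 'Z(I)%VS by rewrite memvZ // component_center_unit.
pose f c := sigma (c *: e).
have fB : zmod_morphism f.
  by move=> a b; apply: (addIr (f b)); rewrite subrK /f -sigmaD // -scalerDl subrK.
have fM : monoid_morphism f.
  split; first by rewrite /f scale1r sigma_unit.
  by move=> a b; rewrite /f -sigmaM // -scalerAl -scalerAr scalerA mul_e.
pose fz := GRing.isZmodMorphism.Build K E f fB.
pose fm := GRing.isMonoidMorphism.Build K E f fM.
by exists (HB.pack_for {rmorphism K -> E} f fz fm).
Qed.

(** [t] is known only through [sigma], so the identity is checked in [E] and pulled back by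
    injectivity of [sigma] on the centre. *)
Lemma central_trace_linear c x y : x \in I -> y \in I -> t (c *: x + y) = c *: t x + t y.
Proof.
move=> xI yI; have cZ : c *: e \in 'Z(I)%VS by rewrite memvZ // component_center_unit.
have [[txZ tx] [tyZ ty]] := (t_trace xI, t_trace yI).
have [tZ te] : t (c *: x + y) \in 'Z(I)%VS /\ sigma (t (c *: x + y)) = \tr (phi (c *: x + y)).
  by apply: t_trace; rewrite memvD ?memvZ.
have ctx : c *: t x = c *: e * t x by rewrite -scalerAl mul_e ?component_center_sub.
have cx : c *: x = c *: e * x by rewrite -scalerAl mul_e.
have hZ : c *: t x + t y \in 'Z(I)%VS by rewrite memvD ?memvZ.
apply/eqP; rewrite -subr_eq0; apply/eqP; apply: sigma_eq0; first exact: memvB.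
apply: (addIr (sigma (c *: t x + t y))); rewrite -sigmaD ?memvB // subrK add0r.
rewrite te phiD ?memvZ // mxtraceD -ty cx phiM ?(component_center_sub cZ) // (phiZ cZ).
rewrite mul_scalar_mx mxtraceZ -tx -sigmaM // -ctx -sigmaD ?memvZ //.
Qed.

(** The equation passes through [phi] to a matrix over [E], whose trace is then integral, and the
    equation of that trace returns through the injective [sigma]. Polynomials are multiplied by [e]
    since constants enter [I] as multiples of [e], not of the unit of [A]. *)
Lemma central_trace_integral (S : comNzRingType) (h : {rmorphism S -> K}) (f : {poly S}) x :
  x \in I -> f \is monic -> (map_poly (in_alg A) (map_poly h f)).[x] * e = 0 ->
  exists2 g : {poly S}, g \is monic & (map_poly (in_alg A) (map_poly h g)).[t x] * e = 0.
Proof.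
move=> xI fmonic fx; have [iota iotaE] := base_embedding.
have [txZ tx] := t_trace xI.
have hornerSe (p : {poly K}) c u : u \in I ->
    (map_poly (in_alg A) (p * 'X + c%:P)).[u] * e =
    (map_poly (in_alg A) p).[u] * e * u + c *: e.
  move=> uI; rewrite rmorphD rmorphM /= map_polyX map_polyC /= hornerMXaddC mulrDl.
  by rewrite mulr_algl -!mulrA mul_e ?mule.
have phi_horner (p : {poly K}) :
    phi ((map_poly (in_alg A) p).[x] * e) = horner_mx (phi x) (map_poly iota p).
  elim/poly_ind: p => [|p c IHp]; first by rewrite !rmorph0 horner0 mul0r splitting0.
  rewrite hornerSe // phiD ?component_mull ?memvZ // phiM ?component_mull // IHp.
  rewrite rmorphD rmorphM /= map_polyX map_polyC /= rmorphD rmorphM /= horner_mx_X horner_mx_C.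
  by rewrite iotaE (phiZ (memvZ _ component_center_unit)).
have hornerZ (p : {poly K}) z : z \in 'Z(I)%VS -> (map_poly (in_alg A) p).[z] * e \in 'Z(I)%VS.
  move=> zZ; elim/poly_ind: p => [|p c IHp].
    by rewrite rmorph0 horner0 mul0r mem0v.
  rewrite hornerSe ?component_center_sub // memvD ?memvZ ?component_center_unit //.
  exact: component_center_mul.
have sigma_horner (p : {poly K}) z : z \in 'Z(I)%VS ->
    sigma ((map_poly (in_alg A) p).[z] * e) = (map_poly iota p).[sigma z].
  move=> zZ; elim/poly_ind: p => [|p c IHp].
    rewrite !rmorph0 !horner0 mul0r; apply: scalar_mx_inj.
    by rewrite -phiZ ?mem0v // splitting0 raddf0.
  rewrite hornerSe ?component_center_sub // sigmaD ?memvZ ?component_center_unit //; last first.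
    by apply: component_center_mul => //; apply: hornerZ.
  rewrite sigmaM ?hornerZ // IHp rmorphD rmorphM /= map_polyX map_polyC /= hornerMXaddC.
  by rewrite iotaE.
have [g gmonic rg] : integralOver (iota \o h) (sigma (t x)).
  rewrite tx; apply: (integral_mxtrace fmonic).
  by rewrite map_poly_comp -phi_horner fx splitting0.
exists g => //; apply: sigma_eq0; first exact: hornerZ.
by rewrite sigma_horner // -map_poly_comp; apply/eqP.
Qed.

End CentralTrace.

(** * Reduced trace of a semisimple algebra *)

Section ReducedTrace.
Variables (K : fieldType) (A : falgType K).

(** The [e i] are the components of 1. For [x] in [I i], both [x = \sum_j e j * x] and
    [x = \sum_j x * e j] are decompositions along the direct sum, so only the term [j = i]
    survives. *)
Lemma wedderburn_idempotents k (I : 'I_k -> {vspace A}) : wedderburn_decomposition I ->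
  exists e : 'I_k -> A, [/\ forall i, e i \in I i, \sum_i e i = 1 &
    forall i x, x \in I i -> e i * x = x /\ x * e i = x].
Proof.
case=> Isimple Idir Isum.
have /memv_sumP[e eI e1] : (1 : A) \in (\sum_(i < k) I i)%VS by rewrite Isum memvf.
exists e; split=> // [i|i x xI]; first exact: eI.
have isum : x = \sum_j (if j == i then x else 0) by rewrite -big_mkcond big_pred1_eq.
have hI j : true -> (if j == i then x else 0) \in I j.
  by move=> _; case: eqP => [->|_]; rewrite ?mem0v.
have uniq (u : 'I_k -> A) : (forall j, u j \in I j) -> x = \sum_j u j -> u i = x.
  move=> uI ex; have := directv_sum_unique Idir u _ (fun j _ => uI j) hI.
  by rewrite -ex -isum eqxx => /esym/forallP/(_ i); rewrite eqxx => /eqP.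
split; [apply: (uniq (fun j => e j * x))|apply: (uniq (fun j => x * e j))].
- by move=> j; apply: component_mulr; rewrite ?eI.
- by rewrite -mulr_suml -e1 mul1r.
- by move=> j; apply: component_mull; rewrite ?eI.
- by rewrite -mulr_sumr -e1 mulr1.
Qed.

(** For [n = 0] the matrix space is zero, its basis is empty, and [I] would be zero. This gives
    access to the lemmas stated for ['M_n.+1]. *)
Lemma splitting_degree_gt0 (I : {vspace A}) (E : fieldType) n (sigma : A -> E)
    (phi : A -> 'M[E]_n) : I <> 0%VS -> splitting I sigma phi -> (0 < n)%N.
Proof.
move=> I0 [_ _ _ [m [b [bI bgen /andP[_ bfree]]]]]; case: n phi bfree => // phi bfree.
case: m b bI bgen bfree => [|m] b bI bgen bfree; last first.
  have /free_not0/(_ (map_f _ _)) := bfree; move=> /(_ ord0); rewrite mem_enum => /(_ isT).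
  by rewrite [phi _]flatmx0 eqxx.
case: I0; apply/eqP; rewrite -subv0; apply/subvP => x xI.
by have [c [[_ ->] _]] := bgen x xI; rewrite big_ord0 mem0v.
Qed.

Lemma field_trace_linear (L : {vspace A}) c x y :
  field_trace L (c *: x + y) = c * field_trace L x + field_trace L y.
Proof.
rewrite /field_trace mulr_sumr -big_split; apply: eq_bigr => i _ /=.
by rewrite mulrDl -scalerAl linearP.
Qed.

Variable tr : A -> K.
Hypothesis tr_reduced : is_reduced_trace tr.

Lemma reduced_trace_linear c x y : tr (c *: x + y) = c * tr x + tr y.
Proof.
case: tr_reduced => k [I [t [Iw It trE]]].
have [e [eI e1 e_unit]] := wedderburn_idempotents Iw; have [Isimple _ _] := Iw.
have eIx z i : z * e i \in I i by apply: component_mull.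
have tr_sum z : tr z = \sum_i field_trace 'Z(I i)%VS (t i (z * e i)).
  by rewrite -trE // -mulr_sumr e1 mulr1.
rewrite !tr_sum mulr_sumr -big_split; apply: eq_bigr => i _ /=.
have [E [n [sigma [phi [spl tt]]]]] := It i.
have [_ I0 _] := Isimple i.
have := splitting_degree_gt0 I0 spl; case: n phi spl tt => // n phi spl tt _.
rewrite -field_trace_linear mulrDl -scalerAl; congr (field_trace _ _).
by apply: (central_trace_linear (Isimple i) (eI i) _ _ spl tt) => // z /(e_unit i)[].
Qed.

(** Integrality is kept twice on each component: by the central trace into the centre, then by the
    field trace from the centre to [K]. *)
Lemma reduced_trace_integral (S : comNzRingType) (h : {rmorphism S -> K}) (f : {poly S}) x :
  f \is monic -> (map_poly (in_alg A) (map_poly h f)).[x] = 0 -> integralOver h (tr x).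
Proof.
move=> fmonic fx; case: tr_reduced => k [I [t [Iw It trE]]].
have [e [eI e1 e_unit]] := wedderburn_idempotents Iw; have [Isimple _ _] := Iw.
have eIx z i : z * e i \in I i by apply: component_mull.
have -> : x = \sum_i x * e i by rewrite -mulr_sumr e1 mulr1.
rewrite trE //; apply: integral_sum => i _.
have [E [n [sigma [phi [spl tt]]]]] := It i.
have [_ I0 _] := Isimple i.
have := splitting_degree_gt0 I0 spl; case: n phi spl tt => // n phi spl tt _.
have eI1 z : z \in I i -> e i * z = z by case/(e_unit i).
have eI2 z : z \in I i -> z * e i = z by case/(e_unit i).
have horner_e (p : {poly K}) :
    (map_poly (in_alg A) p).[x * e i] * e i = (map_poly (in_alg A) p).[x] * e i.
  elim/poly_ind: p => [|p c IHp]; first by rewrite !rmorph0 !horner0.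
  rewrite rmorphD rmorphM /= map_polyX map_polyC /= !hornerMXaddC !mulrDl; congr (_ + _).
  transitivity ((map_poly (in_alg A) p).[x * e i] * e i * (x * e i) * e i).
    by rewrite -(mulrA _ (e i) (x * e i)) eI1.
  by rewrite IHp -!mulrA; congr (_ * _); rewrite [e i * e i]eI2 // eI1.
have fe : (map_poly (in_alg A) (map_poly h f)).[x * e i] * e i = 0.
  by rewrite horner_e fx mul0r.
have [g gmonic gt] := central_trace_integral (Isimple i) (eI i) eI1 eI2 spl tt (eIx x i) fmonic fe.
have [tZ _] := tt _ (eIx x i).
have bZ (j : 'I_(\dim 'Z(I i))) : (vbasis 'Z(I i))`_j \in 'Z(I i)%VS.
  by apply: vbasis_mem; rewrite mem_nth ?size_tuple.
apply: (integral_mul_trace gmonic).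
- exact: basis_free (vbasisP _).
- move=> j; rewrite (span_basis (vbasisP _)).
  exact: (component_center_mul (Isimple i)).
- move=> j; rewrite -[X in _ * X](eI1 _ (component_center_sub (bZ j))) mulrA.
  by rewrite gt mul0r.
Qed.

End ReducedTrace.

(** * Submodules and the trace form *)

Section Submodules.
Variables (R : idomainType) (A : falgType {fraction R}).
Local Notation K := {fraction R}.
Implicit Types (L M Lam Gam S : set A) (x y : A).

Record is_submodule L : Prop := IsSubmodule {
  submodule0 : L 0;
  submoduleD : forall x y, L x -> L y -> L (x + y);
  submoduleZ : forall (r : R) x, L x -> L (r%:F *: x) }.

Lemma submoduleN L x : is_submodule L -> L x -> L (- x).
Proof.
move=> hL Lx; rewrite -scaleN1r -[-1](_ : (- 1 : R)%:F = _); first exact: submoduleZ.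
by rewrite tofracN tofrac1.
Qed.

Lemma submoduleB L x y : is_submodule L -> L x -> L y -> L (x - y).
Proof. by move=> hL Lx Ly; apply: submoduleD => //; apply: submoduleN. Qed.

Lemma submodule_sum L (I : eqType) (s : seq I) (F : I -> A) :
  is_submodule L -> (forall i, i \in s -> L (F i)) -> L (\sum_(i <- s) F i).
Proof.
move=> hL h; rewrite big_seq; elim/big_ind: _ => //; first exact: submodule0.
by move=> x y; apply: submoduleD.
Qed.

Lemma submodule_in_base L (c : K) x : is_submodule L -> in_base c -> L x -> L (c *: x).
Proof. by move=> hL [r ->]; apply: submoduleZ. Qed.

Lemma order_submodule Lam : is_order Lam -> is_submodule Lam.
Proof.
move=> hL; have L0 : Lam 0 by rewrite -(subrr 1); apply: orderB => //; apply: order1.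
split=> // [x y Lx Ly|]; last exact: orderZ.
by rewrite -[y]opprK -[- y]sub0r; do !apply: orderB.
Qed.

Lemma conductor_ideal L x : is_submodule L -> is_ideal [set r : R | L (r%:F *: x)].
Proof.
move=> hL; split=> /=; first by rewrite tofrac0 scale0r; apply: submodule0.
  by move=> r s hr hs; rewrite tofracD scalerDl; apply: submoduleD.
by move=> r s hs; rewrite tofracM -scalerA; apply: submoduleZ.
Qed.

(** From [x = u x + (1 - u) x]. This is the substitute for checking membership locally. *)
Lemma coideal_submodule L (a b : set R) x : is_submodule L -> coideal a b ->
  (forall r, a r -> L (r%:F *: x)) -> (forall r, b r -> L (r%:F *: x)) -> L x.
Proof.
move=> hL [u au bu] La Lb; rewrite -[x]scale1r -tofrac1 -(subrKC u 1) tofracD scalerDl.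
by apply: submoduleD => //; [apply: La|apply: Lb].
Qed.

Lemma Rspan_combination (s : seq A) x : Rspan [set` s] x ->
  exists c : 'I_(size s) -> R, x = \sum_j (c j)%:F *: s`_j.
Proof.
case=> t [ht ->]; have [||c ec] := @collect_combination R A (fun r v => r%:F *: v) s t _ _ ht.
- by move=> v; rewrite tofrac0 scale0r.
- by move=> r r' v; rewrite tofracD scalerDl.
- by exists c.
Qed.

Lemma Rspan_submodule (S : set A) : is_submodule (Rspan S).
Proof.
split; first by exists [::]; rewrite big_nil.
  move=> _ _ [s [hs ->]] [t [ht ->]]; exists (s ++ t); rewrite big_cat; split=> // i.
  by rewrite mem_cat => /orP[/hs|/ht].
move=> r _ [s [hs ->]]; exists [seq (r * i.1, i.2) | i <- s]; split.
  by move=> _ /mapP[i /hs hi ->].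
by rewrite big_map scaler_sumr; apply: eq_bigr => i _; rewrite scalerA tofracM.
Qed.

Lemma Rspan_subset (S : set A) : S `<=` Rspan S.
Proof.
move=> x Sx; exists [:: (1, x)]; rewrite big_seq1 tofrac1 scale1r; split=> // i.
by rewrite inE => /eqP->.
Qed.

Lemma Rspan_min (S L : set A) : is_submodule L -> S `<=` L -> Rspan S `<=` L.
Proof.
move=> hL SL _ [s [hs ->]]; apply: submodule_sum => // i /hs /SL.
exact: submoduleZ.
Qed.

Lemma submodule_preim_mull L y : is_submodule L -> is_submodule [set x | L (y * x)].
Proof.
move=> hL; split=> /=; first by rewrite mulr0; apply: submodule0.
  by move=> u v; rewrite mulrDr; apply: submoduleD.
by move=> r u; rewrite -scalerAr; apply: submoduleZ.
Qed.

Lemma submodule_preim_mulr L y : is_submodule L -> is_submodule [set x | L (x * y)].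
Proof.
move=> hL; split=> /=; first by rewrite mul0r; apply: submodule0.
  by move=> u v; rewrite mulrDl; apply: submoduleD.
by move=> r u; rewrite -scalerAl; apply: submoduleZ.
Qed.

Lemma submodule_preim_scale L (c : K) : is_submodule L -> is_submodule [set x | L (c *: x)].
Proof.
move=> hL; split=> /=; first by rewrite scaler0; apply: submodule0.
  by move=> u v; rewrite scalerDr; apply: submoduleD.
by move=> r u; rewrite scalerA mulrC -scalerA; apply: submoduleZ.
Qed.

End Submodules.

(** * Trace form and Gram matrices *)

Section TraceForm.
Variables (R : idomainType) (A : falgType {fraction R}) (tr : A -> {fraction R}).
Local Notation K := {fraction R}.
Implicit Types (L M Lam Gam : set A) (x y : A).
Hypothesis R_dedekind : is_dedekind R.
Hypothesis tr_reduced : is_reduced_trace tr.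

(** Multiplication by [x] on generators of the order has a matrix over [R]. Its characteristic
    polynomial at [x] kills every generator, hence 1, and so vanishes. *)
Lemma order_trace_in_base Gam x : is_order Gam -> Gam x -> in_base (tr x).
Proof.
move=> hG Gx; apply: (dedekind_integrally_closed R_dedekind).
have [s Gs] := order_fin_generated hG.
have sG (i : 'I_(size s)) : Gam s`_i by rewrite Gs; apply: Rspan_subset; apply: mem_nth.
have combo (i : 'I_(size s)) : exists c : 'I_(size s) -> R, x * s`_i = \sum_j (c j)%:F *: s`_j.
  by apply: Rspan_combination; rewrite -Gs; apply: orderM.
pose M := \matrix_(i, j) projT1 (cid (combo i)) j.
have xM (i : 'I_(size s)) :
    x * s`_i = \sum_j (in_alg A \o @FracField.tofrac R) (M i j) * s`_j.
  rewrite [LHS](projT2 (cid (combo i))).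
  by apply: eq_bigr => j _; rewrite mxE /= mulr_algl.
apply: (reduced_trace_integral tr_reduced (char_poly_monic M)).
rewrite -map_poly_comp -[LHS]mulr1.
have [c ->] : exists c : 'I_(size s) -> R, 1 = \sum_j (c j)%:F *: s`_j.
  by apply: Rspan_combination; rewrite -Gs; apply: order1.
rewrite mulr_sumr big1 // => i _; rewrite -scalerAr.
have -> := char_poly_stable_family _ xM; first exact: scaler0.
by move=> r y; rewrite /= mulr_algl mulr_algr.
Qed.

Let trL := reduced_trace_linear tr_reduced.

Lemma reduced_traceD x y : tr (x + y) = tr x + tr y.
Proof. by rewrite -[x]scale1r trL mul1r scale1r. Qed.

Lemma reduced_trace0 : tr 0 = 0.
Proof. by apply: (addrI (tr 0)); rewrite -reduced_traceD !addr0. Qed.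

Lemma reduced_traceZ c x : tr (c *: x) = c * tr x.
Proof. by rewrite -[c *: x]addr0 trL reduced_trace0 addr0. Qed.

Lemma reduced_trace_sum (I : Type) (s : seq I) (F : I -> A) :
  tr (\sum_(i <- s) F i) = \sum_(i <- s) tr (F i).
Proof. exact: (big_morph tr reduced_traceD reduced_trace0). Qed.

Definition gram n (x : 'I_n -> A) : 'M[K]_n := \matrix_(i, j) tr (x i * x j).

Lemma gram_mul n (x y : 'I_n -> A) (P : 'M[K]_n) :
  (forall i, y i = \sum_j P i j *: x j) -> gram y = P *m gram x *m P^T.
Proof.
move=> yP; apply/matrixP => i j; rewrite !mxE !yP mulr_suml reduced_trace_sum.
under eq_bigr => k _.
  rewrite -scalerAl reduced_traceZ mulr_sumr reduced_trace_sum mulr_sumr.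
  under eq_bigr => l _ do rewrite -scalerAr reduced_traceZ.
  over.
rewrite exchange_big /=; apply: eq_bigr => l _.
rewrite !mxE mulr_suml; apply: eq_bigr => k _.
by rewrite !mxE; ring.
Qed.

Lemma gram_free n (x : 'I_n -> A) : \det (gram x) != 0 -> free [tuple x i | i < n].
Proof.
move=> gx; apply/freeP => c c0 i; apply: contraNeq gx => ci.
apply/det0P; exists (\row_j c j).
  by apply: contraNneq ci => /rowP/(_ i); rewrite !mxE => ->.
apply/rowP => j; rewrite !mxE -[RHS](_ : tr ((\sum_i c i *: x i) * x j) = 0).
  rewrite mulr_suml reduced_trace_sum; apply: eq_bigr => k _.
  by rewrite !mxE -scalerAl reduced_traceZ.
rewrite (_ : \sum_i c i *: x i = 0) ?mul0r ?reduced_trace0 // -[RHS]c0.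
by apply: eq_bigr => k _; rewrite (nth_map k) ?size_enum_ord // nth_ord_enum.
Qed.

Lemma gram_basis_neq0 n (b : n.-tuple A) : trace_form_nondegenerate tr ->
  basis_of fullv b -> \det (gram (fun i : 'I_n => b`_i)) != 0.
Proof.
move=> tr_nondeg hb; apply/negP => /det0P[v v0 vG].
suff x0 : \sum_i v 0 i *: b`_i = 0.
  by case/eqP: v0; apply/rowP => i; rewrite mxE; move/freeP: (basis_free hb); apply.
apply: tr_nondeg => y; rewrite (coord_basis hb (memvf y)) mulr_sumr reduced_trace_sum.
rewrite big1 // => j _; rewrite -scalerAr reduced_traceZ mulr_suml reduced_trace_sum.
rewrite (_ : \sum_i _ = 0) ?mulr0 //.
have /rowP/(_ j) := vG; rewrite !mxE => e; rewrite -[RHS]e; apply: eq_bigr => i _.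
by rewrite mxE -scalerAl reduced_traceZ.
Qed.

(* Every overorder lies in the dual of the lattice spanned by [b]. *)
Lemma overorder_bounded n (b : n.-tuple A) Lam : trace_form_nondegenerate tr ->
  basis_of fullv b -> is_order Lam -> (forall i : 'I_n, Lam b`_i) ->
  exists2 d : R, d != 0 & forall Gam x j, overorder Lam Gam -> Gam x ->
    in_base (d%:F * coord b j x).
Proof.
move=> tr_nondeg hb hL bL; set G := gram (fun i : 'I_n => b`_i).
have GR i j : in_base (G i j).
  by rewrite mxE; apply: (order_trace_in_base hL); apply: orderM.
have [d ed] := in_base_det GR.
have d0 : d != 0 by rewrite -tofrac_eq0 -ed gram_basis_neq0.
exists d => // Gam x j [hG LG] Gx.
pose c := \row_i coord b i x.
have cG : forall i k, in_base ((c *m G) i k).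
  move=> i k; rewrite mxE.
  rewrite (_ : \sum_l _ = tr (x * b`_k)); last first.
    rewrite (coord_basis hb (memvf x)) mulr_suml reduced_trace_sum.
    by apply: eq_bigr => l _; rewrite !mxE -scalerAl reduced_traceZ.
  by apply: (order_trace_in_base hG); apply: orderM => //; apply: LG.
(* Cramer's rule: the coordinates are recovered from the traces against [b] by the adjugate, with
   denominator [d]. *)
have -> : d%:F * coord b j x = (c *m G *m \adj G) 0 j.
  by rewrite -mulmxA mul_mx_adj mul_mx_scalar !mxE ed.
rewrite mxE; apply: in_base_sum => k _; apply: in_baseM => //.
rewrite !mxE; apply: in_baseM; last first.
  by apply: in_base_det => u v; rewrite !mxE; apply: (order_trace_in_base hL); apply: orderM.
by rewrite -signr_odd; case: odd; rewrite ?expr0 ?expr1; [apply: in_baseN|]; apply: in_base1.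
Qed.

End TraceForm.

(** * The discriminant *)

Section LocalFractions.
Variable R : idomainType.
Local Notation K := {fraction R}.
Implicit Types (p : set R) (d : K).

Definition local_at p d : Prop := exists a s : R, ~ p s /\ d * s%:F = a%:F.

(** The local ring at [p] is a valuation ring. Write [d = a / b]. As [(a, b)] is invertible, some
    [u] in its inverse and [v] in it have product outside [p], so [u * a] and [u * b] lie in [R] but
    not both in [p]. Since [d] is not local, [u * b] is the one in [p]. *)
Lemma local_or_inv p d : is_dedekind R -> is_prime_ideal p -> ~ local_at p d ->
  d != 0 /\ exists a s : R, [/\ p a, ~ p s & d^-1 * s%:F = a%:F].
Proof.
move=> Rd [hp np1 pM] nloc; have [a [b [b0 dE]]] := fraction_repr d.
have d0 : d != 0.
  apply/eqP => d0; apply: nloc; exists 0, 1; split=> //.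
  by rewrite d0 mul0r tofrac0.
split=> //.
pose I := ideal_add (principal a) (principal b).
have Iid : is_ideal I by apply: ideal_add_ideal; apply: principal_ideal.
have Ib : I b by apply: ideal_add_subr (principal_id b); apply: principal_ideal.
have Ia : I a by apply: ideal_add_subl (principal_id a); apply: principal_ideal.
have [t [ht et]] := ideal_invertible Rd Iid (nonzero_ideal Ib b0).
have [u [v [hu Iv [w nw ew]]]] : exists u v, [/\ ideal_inv I u, I v &
    exists2 w, ~ p w & u * v%:F = w%:F].
  apply: contrapT => h; apply: np1.
  have hw i : exists w, i \in t -> p w /\ i.1 * i.2%:F = w%:F.
    have [it|_] := boolP (i \in t); last by exists 0.
    have [h1 h2] := ht i it; have [w ew] := h1 _ h2; exists w => _; split=> //.
    by apply: contrapT => nw; apply: h; exists i.1, i.2; split=> //; exists w.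
  have -> : 1 = \sum_(i <- t) projT1 (cid (hw i)).
    apply: tofrac_inj; rewrite tofrac1 -et rmorph_sum big_seq [RHS]big_seq.
    by apply: eq_bigr => i it; case: cid => /= w /(_ it)[].
  by apply: ideal_sum => // i it; case: cid => /= w /(_ it)[].
have [[a' ea] [b' eb]] := (hu a Ia, hu b Ib).
have bF : b%:F != 0 :> K by rewrite tofrac_eq0.
have db' : d * b'%:F = a'%:F by rewrite -ea -eb dE mulrCA mulrA mulrA mulfVK // mulrC.
have pb' : p b' by apply: contrapT => nb'; apply: nloc; exists a', b'.
exists b', a'; split=> //; last by rewrite -db' mulKf.
move=> pa'; apply: nw; case: Iv => _ [_ [[r ->] [s ->] ev]].
have -> : w = r * a' + s * b'.
  by apply: tofrac_inj; rewrite -ew ev !tofracD !tofracM -ea -eb; ring.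
by apply: idealD => //; apply: idealM.
Qed.

Lemma local_common_denominator p n (d : 'I_n -> K) : is_prime_ideal p ->
  (forall i, local_at p (d i)) -> exists2 s, ~ p s & forall i, in_base (s%:F * d i).
Proof.
move=> [hp np1 pM] dloc.
have h i : exists s, ~ p s /\ in_base (s%:F * d i).
  by have [a [s [ns e]]] := dloc i; exists s; split=> //; exists a; rewrite mulrC.
pose f i := projT1 (cid (h i)).
have fP i : ~ p (f i) /\ in_base ((f i)%:F * d i) by rewrite /f; case: cid.
exists (\prod_i f i).
  elim/big_ind: _ => //; last by move=> i _; case: (fP i).
  by move=> x y nx ny /pM[].
move=> i; rewrite (bigD1 i) //= tofracM mulrAC; apply: in_baseM; first by case: (fP i).
exact: in_base_tofrac.
Qed.

End LocalFractions.

Section Discriminant.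
Variables (R : idomainType) (A : falgType {fraction R}) (tr : A -> {fraction R}).
Local Notation K := {fraction R}.
Implicit Types (L M Lam Gam : set A) (x y : A) (p : set R).
Hypothesis R_dedekind : is_dedekind R.
Hypothesis tr_reduced : is_reduced_trace tr.

Lemma coideal_principal p s k : is_maximal_ideal p -> ~ p s ->
  coideal (principal s) (ideal_exp p k).
Proof.
move=> pmax ns; have [hp _ _] := pmax.
apply: coideal_exp => //; first exact: principal_ideal.
apply: coideal_maximal => //; first exact: principal_ideal.
by move=> /(_ s (principal_id s)).
Qed.

(* Expanding [y] in [x], some coefficient [d j] is not in the local ring at [p],
   so [1 / d j] is in its maximal ideal.  Replacing [x j] by [y] multiplies the
   Gram determinant, which stays in [R] as [y] lies in an order, by [d j ^ 2]. *)
Lemma disc_sub_prime_sqr p k Lam Gam y : nonzero_prime p -> is_order Lam ->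
  overorder Lam Gam -> Gam y -> ~ Lam y ->
  (forall r, ideal_exp p k r -> Lam (r%:F *: y)) -> disc tr Lam `<=` ideal_exp p 2.
Proof.
move=> pp hL [hG LG] Gy nLy pky; have pmax := nonzero_prime_maximal R_dedekind pp.
have [pprime _] := pp; have [hp np1 pM] := pprime.
have hsub := order_submodule hL.
apply: ideal_gen_min; first exact: ideal_exp_ideal.
move=> D [x [Lx]]; rewrite -/(gram tr x) => eD.
have [D0|D0] := eqVneq D 0; first by rewrite D0; apply: ideal0; apply: ideal_exp_ideal.
have xfree : free [tuple x i | i < \dim {:A}].
  by apply: (gram_free tr_reduced); rewrite -eD tofrac_eq0.
have xbasis : basis_of fullv [tuple x i | i < \dim {:A}].
  by rewrite basisEfree xfree subvf size_tuple /=.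
pose d i := coord [tuple x i | i < \dim {:A}] i y.
have yE : y = \sum_i d i *: x i.
  rewrite [LHS](coord_basis xbasis (memvf y)); apply: eq_bigr => i _.
  by rewrite (nth_map i) ?size_enum_ord // nth_ord_enum.
have [dloc|/existsNP[j nloc]] := pselect (forall i, local_at p (d i)).
  (* If all coefficients were local, some [s] outside [p] would send [y] into [Lam]. So does
     [p ^ k], which is comaximal with [s], and [y] would be in [Lam]. *)
  have [s ns sd] := local_common_denominator pprime dloc.
  case: nLy; apply: (coideal_submodule hsub (coideal_principal k pmax ns)) => // _ [r ->].
  rewrite tofracM -scalerA; apply: submoduleZ => //; rewrite yE scaler_sumr.
  by apply: submodule_sum => // i _; rewrite scalerA; apply: submodule_in_base.
have [dj0 [a [s [pa ns das]]]] := local_or_inv R_dedekind pprime nloc.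
pose x' i := if i == j then y else x i.
pose P := \matrix_(i, l) (if i == j then d l else (i == l)%:R).
have gx' : gram tr x' = P *m gram tr x *m P^T.
  apply: (gram_mul tr_reduced) => i; rewrite /x'; have [->|ij] := eqVneq i j.
    by rewrite yE; apply: eq_bigr => l _; rewrite mxE eqxx.
  rewrite (bigD1 i) //= big1 ?addr0 => [|l li]; rewrite mxE (negPf ij).
    by rewrite eqxx scale1r.
  by rewrite eq_sym (negPf li) scale0r.
(* [P] is the identity with row [j] replaced by [d]. Cofactors along row [j] do not see that row, so
   they are those of the identity. *)
have detP : \det P = d j.
  rewrite (expand_det_row P j) (bigD1 j) //= big1 ?addr0 => [|l lj].
    rewrite mxE eqxx (_ : cofactor P j j = cofactor 1%:M j j).
      by have /matrixP/(_ j j) := adj1 K (\dim {:A}); rewrite !mxE eqxx => ->; rewrite mulr1.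
    congr (_ * \det _); apply/matrixP => u v; rewrite !mxE.
    by rewrite eq_sym (negPf (neq_lift _ _)).
  rewrite (_ : cofactor P j l = cofactor 1%:M j l).
    by have /matrixP/(_ l j) := adj1 K (\dim {:A}); rewrite !mxE (negPf lj) => ->; rewrite mulr0.
  congr (_ * \det _); apply/matrixP => u v; rewrite !mxE.
  by rewrite eq_sym (negPf (neq_lift _ _)).
have [e ee] : in_base (\det (gram tr x')).
  apply: in_base_det => u v; rewrite mxE.
  apply: (order_trace_in_base R_dedekind tr_reduced hG); apply: orderM => //.
    by rewrite /x'; case: eqP => // _; apply: LG.
  by rewrite /x'; case: eqP => // _; apply: LG.
have eE : e%:F = d j * d j * D%:F.
  by rewrite -ee gx' !det_mulmx det_tr detP eD; ring.
have sD : s * s * D = a * a * e.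
  apply: tofrac_inj; rewrite !tofracM eE -das.
  have -> : (d j)^-1 * s%:F * ((d j)^-1 * s%:F) * (d j * d j * D%:F) =
    ((d j)^-1 * d j) * ((d j)^-1 * d j) * (s%:F * s%:F * D%:F) by ring.
  by rewrite mulVf // !mul1r.
(* [s * s] is invertible modulo [p ^ 2], so it can be cancelled from [s * s * D] in [p ^ 2]. *)
have nss : ~ p (s * s) by move=> /pM[].
have [_ [r ->] pu] := coideal_principal 2 pmax nss.
have p2 := ideal_exp_ideal p 2.
rewrite -[D]mul1r -(subrKC (r * (s * s)) 1) mulrDl.
apply: (idealD p2); last exact: (idealM_right _ p2 pu).
rewrite -[r * (s * s) * D]mulrA sD; apply: (idealM p2); apply: (idealM_right _ p2).
by rewrite -[X in _ * X]mulr1; do !apply: mem_ideal_mul.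
Qed.

End Discriminant.

(** * Bounded submodules are finitely generated and projective *)

Section BoundedSubmodules.
Variables (R : idomainType) (A : falgType {fraction R}).
Local Notation K := {fraction R}.
Implicit Types (L M Lam Gam : set A) (x y : A).
Hypothesis R_dedekind : is_dedekind R.

Definition dual_basis L (t : seq ((A -> K) * A)) : Prop :=
  [/\ forall i, i \in t -> L i.2,
      forall i x, i \in t -> L x -> in_base (i.1 x),
      forall i c x y, i \in t -> i.1 (c *: x + y) = c * i.1 x + i.1 y
    & forall x, L x -> x = \sum_(i <- t) i.1 x *: i.2].

(* Induction on the number of non-zero coordinates: the last one maps the module
   onto an invertible, hence projective, fractional ideal. *)
Lemma bounded_dual_basis n (b : n.-tuple A) L (d : R) : basis_of fullv b ->
  is_submodule L -> d != 0 ->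
  (forall x j, L x -> in_base (d%:F * coord b j x)) ->
  exists t, dual_basis L t.
Proof.
move=> hb + d0; have dF : d%:F != 0 :> K by rewrite tofrac_eq0.
suff : forall m, (m <= n)%N -> forall M, is_submodule M ->
    (forall x j, M x -> in_base (d%:F * coord b j x)) ->
    (forall x (j : 'I_n), M x -> (m <= j)%N -> coord b j x = 0) -> exists t, dual_basis M t.
  move=> H hL Ld; apply: (H n) => // x j _; by rewrite leqNgt ltn_ord.
elim=> [_|m IHm mn] M hM Md M0.
  exists [::]; split=> // x Mx; rewrite big_nil (coord_basis hb (memvf x)).
  by rewrite big1 // => j _; rewrite M0 ?scale0r.
pose j := Ordinal mn; pose c := coord b j.
have c0 : c 0 = 0 by rewrite /c linear0.
have cD u v : c (u + v) = c u + c v by rewrite /c linearD.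
have cZ (a : K) u : c (a *: u) = a * c u by rewrite /c linearZ.
pose I : set R := [set r | exists2 x, M x & d%:F * c x = r%:F].
have Iid : is_ideal I.
  split.
  - by exists 0; [apply: submodule0|rewrite c0 mulr0 tofrac0].
  - move=> r s [x Mx ex] [y My ey]; exists (x + y); first exact: submoduleD.
    by rewrite cD mulrDr ex ey tofracD.
  - move=> r s [x Mx ex]; exists (r%:F *: x); first exact: submoduleZ.
    by rewrite cZ mulrCA ex tofracM.
have inI x : M x -> exists2 r, I r & d%:F * c x = r%:F.
  by move=> Mx; have [r er] := Md x j Mx; exists r => //; exists x.
have [I0|In0] := pselect (I = [set 0]).
  apply: (IHm (ltnW mn) M hM Md) => x i Mx; rewrite leq_eqVlt => /predU1P[ij|]; last exact: M0.
  have -> : i = j by apply: val_inj.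
  have [r] := inI x Mx; rewrite I0 => -> /eqP.
  by rewrite tofrac0 mulf_eq0 (negPf dF) => /eqP.
have [s [hs es]] := ideal_invertible R_dedekind Iid In0.
have hy i : exists y, i \in s -> M y /\ d%:F * c y = i.2%:F.
  by have [/hs[_ [y My ey]]|_] := boolP (i \in s); [exists y|exists 0].
pose y i := projT1 (cid (hy i)).
have yP i : i \in s -> M (y i) /\ d%:F * c (y i) = i.2%:F by rewrite /y; case: cid.
(* [sec] is a section over the ideal [I]: it depends on [c x] only and has the same [c], so
   [x - sec x] lies in the kernel, which has one coordinate fewer. *)
pose sec x := \sum_(i <- s) (i.1 * (d%:F * c x)) *: y i.
have usec i x : i \in s -> M x -> in_base (i.1 * (d%:F * c x)).
  by move=> /hs[ui _] /inI[r Ir ->]; apply: ui.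
have Msec x : M x -> M (sec x).
  move=> Mx; apply: submodule_sum => // i si.
  by apply: submodule_in_base; [|exact: usec|case: (yP i si)].
have secL a x z : sec (a *: x + z) = a *: sec x + sec z.
  rewrite /sec scaler_sumr -big_split; apply: eq_bigr => i _ /=.
  by rewrite scalerA -scalerDl cD cZ; congr (_ *: _); ring.
have csec x : c (sec x) = c x.
  rewrite /sec (big_morph c cD c0) -[RHS]mul1r -es mulr_suml big_seq [RHS]big_seq.
  apply: eq_bigr => i /yP[_ <-]; rewrite cZ; ring.
pose M' : set A := [set x | M x /\ c x = 0].
have [||x i [Mx cx]|t [tM tR tL tE]] := IHm (ltnW mn) M'.
- split; first by split; [exact: submodule0|exact: c0].
    by move=> u v [Mu cu] [Mv cv]; split; [exact: submoduleD|rewrite cD cu cv addr0].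
  by move=> r u [Mu cu]; split; [exact: submoduleZ|rewrite cZ cu mulr0].
- by move=> x i [Mx _]; apply: Md.
- rewrite leq_eqVlt => /predU1P[ij|]; last exact: M0.
  by rewrite -cx; congr (coord _ _ _); apply: val_inj.
have M'sec x : M x -> M' (x - sec x).
  by move=> Mx; split; [apply: submoduleB => //; apply: Msec|rewrite cD -scaleN1r cZ csec mulN1r subrr].
exists ([seq ((fun x => i.1 (x - sec x)), i.2) | i <- t] ++
        [seq ((fun x => i.1 * (d%:F * c x)), y i) | i <- s]); split.
- move=> i; rewrite mem_cat => /orP[] /mapP[k ks ->] /=; first by case: (tM k ks).
  by case: (yP k ks).
- move=> i x; rewrite mem_cat => /orP[] /mapP[k ks ->] /= Mx; last exact: usec.
  by apply: tR => //; apply: M'sec.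
- move=> i a x z; rewrite mem_cat => /orP[] /mapP[k ks ->] /=.
    by rewrite secL -tL //; congr (k.1 _); rewrite scalerBr opprD addrACA.
  by rewrite cD cZ; ring.
- move=> x Mx; rewrite big_cat !big_map /= -(tE _ (M'sec x Mx)).
  by rewrite -/(sec x) subrK.
Qed.

Lemma dual_basis_fin_generated L t : is_submodule L -> dual_basis L t -> fin_generated L.
Proof.
move=> hL [tL tR _ tE]; exists [seq i.2 | i <- t]; apply/seteqP; split=> x; last first.
  case=> s [hs ->]; apply: submodule_sum => // i /hs /mapP[k kt ->].
  by apply: submoduleZ => //; apply: tL.
move=> Lx; have h i : exists r, i \in t -> i.1 x = r%:F.
  by have [/tR/(_ Lx)[r er]|_] := boolP (i \in t); [exists r|exists 0].
exists [seq (projT1 (cid (h i)), i.2) | i <- t]; split.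
  by move=> _ /mapP[i it ->]; apply: map_f.
rewrite [LHS](tE x Lx) big_map [LHS]big_seq [RHS]big_seq.
by apply: eq_bigr => i it; case: cid => /= r ->.
Qed.

(** Turns values of functionals into scalars for an arbitrary [R]-module; the default 0 does not
    matter on [L], where the values lie in [R]. *)
Definition base_part (c : K) : R :=
  if pselect (in_base c) is left h then projT1 (cid h) else 0.

Lemma base_partK c : in_base c -> (base_part c)%:F = c.
Proof. by rewrite /base_part; case: pselect => // h _; case: cid. Qed.

Lemma dual_basis_projective L t : is_submodule L -> dual_basis L t -> projective L.
Proof.
move=> hL [tL tR tlin tE] M N g f gsurj flin.
pose lift (w : N) := projT1 (cid (gsurj w)).
have liftK (w : N) : g (lift w) = w by rewrite /lift; case: cid.
exists (fun x => \sum_(i <- t) base_part (i.1 x) *: lift (f i.2)); split.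
  move=> r x y Lx Ly; rewrite scaler_sumr -big_split big_seq [RHS]big_seq.
  apply: eq_bigr => i it /=; rewrite scalerA -scalerDl; congr (_ *: _).
  have [xR yR] := (tR i x it Lx, tR i y it Ly).
  apply: tofrac_inj; rewrite tlin // tofracD tofracM !base_partK //.
  by apply: in_baseD => //; apply: in_baseM; first exact: in_base_tofrac.
move=> x Lx; rewrite linear_sum [in RHS](tE x Lx).
have f0 : f 0 = 0.
  have := flin 1 0 0 (submodule0 hL) (submodule0 hL).
  by rewrite scaler0 addr0 scale1r -[LHS]addr0 => /addrI.
(* [f] is linear only on [L], so the sum is treated sublist by sublist, with every partial sum in
   [L]. *)
have : {subset t <= t} by [].
elim: {-2}t => [|i s IHs] st; first by rewrite !big_nil f0.
have it : i \in t by apply: st; rewrite mem_head.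
have st' : {subset s <= t} by move=> k ks; apply: st; rewrite inE ks orbT.
have Ls : L (\sum_(k <- s) k.1 x *: k.2).
  by apply: submodule_sum => // k ks; apply: submodule_in_base; [|apply: tR|apply: tL]; rewrite ?st'.
rewrite !big_cons IHs // linearZ /= liftK -{2}(base_partK (tR i x it Lx)) flin //.
exact: tL.
Qed.

(** The source of new orders: only closure and bounded denominators remain to be checked. *)
Lemma bounded_order n (b : n.-tuple A) Lam L (d : R) : basis_of fullv b -> is_order Lam ->
  is_submodule L -> Lam `<=` L -> (forall x y, L x -> L y -> L (x * y)) ->
  d != 0 -> (forall x j, L x -> in_base (d%:F * coord b j x)) -> is_order L.
Proof.
move=> hb hLam hL LamL LM d0 Ld; have [t ht] := bounded_dual_basis hb hL d0 Ld.
split=> //.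
- by apply: LamL; apply: order1.
- by move=> x y; apply: submoduleB.
- by move=> r x; apply: submoduleZ.
- exact: dual_basis_fin_generated ht.
- exact: dual_basis_projective ht.
- by have [c hc cL] := order_basis hLam; exists c => // x /cL/LamL.
Qed.

End BoundedSubmodules.

(** * Primary torsion modules *)

Section IdealPowers.
Variable R : idomainType.
Implicit Types (a b c p : set R).

Lemma ideal_exp_neq0 p k : p <> [set 0] -> is_ideal p -> ideal_exp p k <> [set 0].
Proof.
move=> pn0 hp; have [x px x0] := ideal_neq0 hp pn0.
suff pk : ideal_exp p k (x ^+ k) by apply: (nonzero_ideal pk); rewrite expf_neq0.
by elim: k => // k IHk; rewrite exprS; apply: mem_ideal_mul.
Qed.

(** With [1 = \sum u * v] for [c], [r = \sum u * (r * v)], and multiplication by [u] in the inverse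
    of [c] sends [a c] into [a]. *)
Lemma ideal_cancel a c r : is_dedekind R -> is_ideal a -> is_ideal c -> c <> [set 0] ->
  (forall v, c v -> ideal_mul a c (r * v)) -> a r.
Proof.
move=> Rd ha hc cn0 rc; have [s [hs es]] := ideal_invertible Rd hc cn0.
have uac u y : ideal_inv c u -> ideal_mul a c y -> exists2 t, a t & u * y%:F = t%:F.
  move=> cu; move: y; suff: ideal_mul a c `<=` [set y | exists2 t, a t & u * y%:F = t%:F].
    by [].
  apply: ideal_mul_min; last first.
    move=> x v ax cv; have [t et] := cu v cv; exists (t * x); first exact: idealM.
    by rewrite !tofracM -et; ring.
  split=> /=; first by exists 0; [apply: ideal0|rewrite tofrac0 mulr0].
    move=> x y [t at_ et] [w aw ew]; exists (t + w); first exact: idealD.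
    by rewrite !tofracD mulrDr et ew.
  move=> x y [t at_ et]; exists (x * t); first exact: idealM.
  by rewrite !tofracM mulrCA et.
have h i : exists t, i \in s -> a t /\ i.1 * (r * i.2)%:F = t%:F.
  have [/hs[ci ii]|_] := boolP (i \in s); last by exists 0.
  by have [t at_ et] := uac _ _ ci (rc _ ii); exists t.
have -> : r = \sum_(i <- s) projT1 (cid (h i)).
  apply: tofrac_inj; rewrite -[LHS]mulr1 -es mulr_sumr rmorph_sum big_seq [RHS]big_seq.
  apply: eq_bigr => i si; case: cid => /= t /(_ si)[_ <-].
  by rewrite tofracM mulrCA.
by apply: ideal_sum => // i si; case: cid => /= t /(_ si)[].
Qed.

Lemma big_ideal_mul_exp p k (e : 'I_k -> nat) :
  \big[@ideal_mul R/setT]_(j < k) ideal_exp p (e j) = ideal_exp p (\sum_j e j).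
Proof.
apply: (big_ind2 (fun u v => u = ideal_exp p v)) => //.
by move=> _ m _ n -> ->; rewrite ideal_expD.
Qed.

Lemma big_ideal_mul_sub (I : eqType) (s : seq I) (a : I -> set R) i :
  (forall j, is_ideal (a j)) -> i \in s -> \big[@ideal_mul R/setT]_(j <- s) a j `<=` a i.
Proof.
move=> ha; elim: s => // j s IHs; rewrite inE big_cons => /predU1P[->|is_].
  exact: ideal_mul_subl.
apply: subset_trans (IHs is_); apply: ideal_mul_subr.
by case: s {IHs is_} => [|l s]; rewrite ?big_nil ?big_cons; [exact: idealT|exact: ideal_mul_ideal].
Qed.

End IdealPowers.

(** * Cyclic decomposition of primary modules *)

Section PrimaryModules.
Variables (R : idomainType) (A : falgType {fraction R}).
Local Notation K := {fraction R}.
Implicit Types (L M Lam Gam : set A) (x y : A) (p : set R).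
Hypothesis R_dedekind : is_dedekind R.

Definition ideal_kills (a : set R) L x : Prop := forall r, a r -> L (r%:F *: x).

Lemma index_ideal_kills Gam Lam (c : set R) x : is_submodule Lam ->
  is_index_ideal Gam Lam c -> Gam x -> ideal_kills c Lam x.
Proof.
move=> hL [k [a [g [ha _ gen rel ->]]]] Gx q cq; have [r Lr] := gen x Gx.
rewrite -[x](subrK (\sum_j (r j)%:F *: g j)) scalerDr; apply: submoduleD => //.
  exact: submoduleZ.
rewrite scaler_sumr.
under eq_bigr => j _ do rewrite scalerA -tofracM.
apply/rel => j; apply: idealM_right; first by case: (ha j).
have ha' i : is_ideal (a i) by case: (ha i).
exact: (@big_ideal_mul_sub R _ (index_enum 'I_k) a j ha' (mem_index_enum j)).
Qed.

Definition adjoin_elt L y : set A := [set x | exists r : R, L (x - r%:F *: y)].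

Lemma adjoin_elt_submodule L y : is_submodule L -> is_submodule (adjoin_elt L y).
Proof.
move=> hL; split.
- by exists 0; rewrite tofrac0 scale0r subr0; apply: submodule0.
- move=> u v [r Lu] [s Lv]; exists (r + s).
  by rewrite tofracD scalerDl opprD addrACA; apply: submoduleD.
- move=> r u [s Lu]; exists (r * s).
  by rewrite tofracM -scalerA -scalerBr; apply: submoduleZ.
Qed.

Lemma adjoin_elt_sub L y : L `<=` adjoin_elt L y.
Proof. by move=> x Lx; exists 0; rewrite tofrac0 scale0r subr0. Qed.

Lemma adjoin_elt_mem L y : is_submodule L -> adjoin_elt L y y.
Proof. by move=> hL; exists 1; rewrite tofrac1 scale1r subrr; apply: submodule0. Qed.

(* [R / a1] is injective over itself: a class of annihilator [a] modulo
   [L + R x1] lifts to a class of annihilator [a] modulo [L]. *)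
Lemma lift_annihilator L (a a1 : set R) x1 y : is_submodule L ->
  is_ideal a -> is_ideal a1 -> a1 <> [set 0] -> a1 `<=` a ->
  (forall r, L (r%:F *: x1) -> a1 r) -> ideal_kills a1 L y ->
  ideal_kills a (adjoin_elt L x1) y ->
  exists rho : R, ideal_kills a L (y - rho%:F *: x1).
Proof.
move=> hL ha ha1 a1n0 a1a x1_ann a1y ay.
have [q0 a1q0 q0n0] := ideal_neq0 ha1 a1n0.
have an0 : a <> [set 0] by apply: (nonzero_ideal (a1a _ a1q0)).
(* If [v] is in the quotient of [a1] by [a], then [v * q] is in [a1] and kills [y], so [v * rho]
   kills [x1] and lies in [a1], which is [a] times the quotient. Cancelling the quotient leaves
   [rho] in [a]. *)
have mem_a q rho : a q -> L (q%:F *: y - rho%:F *: x1) -> a rho.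
  move=> aq Lq; have hq := ideal_quotient_ideal a ha1.
  apply: (ideal_cancel (c := ideal_quotient a1 a)) => //.
    apply: (nonzero_ideal (x := q0)) => // z _.
    exact: idealM_right.
  move=> v hv; rewrite ideal_mul_quotient //; apply: x1_ann.
  have -> : (rho * v)%:F *: x1 = (v * q)%:F *: y - v%:F *: (q%:F *: y - rho%:F *: x1).
    by rewrite scalerBr !scalerA -!tofracM subKr mulrC.
  by apply: submoduleB => //; [apply: a1y; apply: hv|apply: submoduleZ].
have [s [hs es]] := ideal_invertible R_dedekind ha an0.
have h i : exists rho, i \in s -> L (i.2%:F *: y - rho%:F *: x1).
  by have [/hs[_ /ay[rho Lr]]|_] := boolP (i \in s); [exists rho|exists 0].
pose rho i := projT1 (cid (h i)).
have rhoP i : i \in s -> L (i.2%:F *: y - (rho i)%:F *: x1) by rewrite /rho; case: cid.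
have hw i : exists w, i \in s -> i.1 * (rho i)%:F = w%:F.
  have [si|_] := boolP (i \in s); last by exists 0.
  have [ai aj] := hs i si; have [w ew] := ai _ (mem_a _ _ aj (rhoP i si)).
  by exists w.
pose w i := projT1 (cid (hw i)).
have wP i : i \in s -> i.1 * (rho i)%:F = (w i)%:F by rewrite /w; case: cid.
(* The sum of [u * rho] over [1 = \sum u * v], where [v y] is [rho x1] modulo [L]; each term lies in
   [R] because [rho] lies in [a]. *)
exists (\sum_(i <- s) w i) => q aq.
have -> : q%:F *: (y - (\sum_(i <- s) w i)%:F *: x1) =
    \sum_(i <- s) (q%:F * i.1) *: (i.2%:F *: y - (rho i)%:F *: x1).
  rewrite scalerBr -[q%:F in X in X - _]mulr1 -es rmorph_sum /= scalerA !mulr_sumr.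
  rewrite !scaler_suml -sumrB big_seq [RHS]big_seq; apply: eq_bigr => i si.
  by rewrite scalerBr !scalerA -mulrA -wP // -!mulrA.
apply: submodule_sum => // i si; apply: submodule_in_base => //; last exact: rhoP.
by have [ai _] := hs i si; have [t et] := ai q aq; exists t; rewrite mulrC.
Qed.

Definition cons_ord (T : Type) k (u : T) (v : 'I_k -> T) (i : 'I_k.+1) : T :=
  if unlift ord0 i is Some j then v j else u.

Lemma cons_ord0 (T : Type) k (u : T) (v : 'I_k -> T) : cons_ord u v ord0 = u.
Proof. by rewrite /cons_ord unlift_none. Qed.

Lemma cons_ordS (T : Type) k (u : T) (v : 'I_k -> T) j : cons_ord u v (lift ord0 j) = v j.
Proof. by rewrite /cons_ord liftK. Qed.

Variables (T : finType) (rep : T -> A).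

(** A finite shadow of a submodule. Once [rep] meets all the relevant classes, strict inclusions
    become visible on shadows and their cardinals can drive inductions. *)
Definition rep_set L : {set T} := [set t | `[< L (rep t) >]]%SET.

Lemma in_rep_set L t : (t \in rep_set L) <-> L (rep t).
Proof. by rewrite /rep_set finset.inE; split=> [/asboolP|?] //; apply/asboolP. Qed.

Lemma rep_set_sub L M : L `<=` M -> rep_set L \subset rep_set M.
Proof. by move=> LM; apply/fintype.subsetP => t /in_rep_set/LM ?; apply/in_rep_set. Qed.

Lemma rep_set_proper L M x : L `<=` M -> is_submodule L -> is_submodule M ->
  (exists t, L (x - rep t)) -> M x -> ~ L x -> rep_set L \proper rep_set M.
Proof.
move=> LM hL hM [t Lt] Mx nLx; apply/properP; split; first exact: rep_set_sub.
exists t; first apply/in_rep_set.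
  by rewrite -[rep t](subKr x); apply: submoduleB => //; apply: LM.
apply/negP => /in_rep_set Lr; apply: nLx; rewrite -[x](subrK (rep t)).
exact: submoduleD.
Qed.

(** Split off an element [x1] whose annihilator is the exact exponent of [Gam / L], decompose modulo
    [L + R x1] by induction, and correct the generators by multiples of [x1] so that they keep their
    annihilators modulo [L]. *)
Lemma primary_cyclic_decomposition p N Gam L : nonzero_prime p -> is_submodule Gam ->
  is_submodule L -> L `<=` Gam -> (forall x, Gam x -> exists t, L (x - rep t)) ->
  (forall x, Gam x -> ideal_kills (ideal_exp p N) L x) ->
  exists (k : nat) (e : 'I_k -> nat) (g : 'I_k -> A),
    [/\ forall j, Gam (g j),
        forall y, Gam y -> exists r : 'I_k -> R, L (y - \sum_j (r j)%:F *: g j)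
      & forall r : 'I_k -> R,
          L (\sum_j (r j)%:F *: g j) <-> forall j, ideal_exp p (e j) (r j)].
Proof.
move=> pp hG; have pmax := nonzero_prime_maximal R_dedekind pp.
have [_ pn0] := pp; have [hp np1 _] := pmax.
have [m] := ubnP (#|T| - #|rep_set L|)%N; move: N L.
elim: m => [N L|m IHm N L Lm hL LG Lrep GN]; first by rewrite ltn0.
pose P n := `[< forall x, Gam x -> ideal_kills (ideal_exp p n) L x >].
have [|N0 /asboolP N0P N0min] := @ex_minnP P; first by exists N; apply/asboolP.
case: N0 => [|N'] in N0P N0min *.
  exists 0%N, (fun=> 0%N), (fun=> 0); split=> [[]//|y Gy|r].
    exists (fun=> 0); rewrite big_ord0 subr0 -[y]scale1r -tofrac1; exact: N0P.
  by split=> [_ []//|_]; rewrite big_ord0; apply: submodule0.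
have [x1 [Gx1 [r0 [pr0 nLr0]]]] : exists x1, Gam x1 /\
    exists r, ideal_exp p N' r /\ ~ L (r%:F *: x1).
  apply: contrapT => h; suff : P N' by move/N0min; rewrite ltnn.
  apply/asboolP => x Gx r pr; apply: contrapT => nL.
  by apply: h; exists x; split=> //; exists r.
have nLx1 : ~ L x1 by move=> /(submoduleZ hL r0).
pose L' := adjoin_elt L x1.
have hL' : is_submodule L' by apply: adjoin_elt_submodule.
have LL' : L `<=` L' by apply: adjoin_elt_sub.
have prop : rep_set L \proper rep_set L'.
  by apply: (rep_set_proper LL' hL hL' (Lrep _ Gx1)) => //; apply: adjoin_elt_mem.
have L'G : L' `<=` Gam.
  move=> x [r Lx]; rewrite -[x](subrK (r%:F *: x1)); apply: submoduleD => //; first exact: LG.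
  exact: submoduleZ.
(* The annihilator contains [p ^ N'.+1], hence is a power of [p]; [r0] rules out every smaller
   exponent. *)
have x1_ann : [set r : R | L (r%:F *: x1)] = ideal_exp p N'.+1.
  have hann := conductor_ideal x1 hL.
  have [j] := ideal_contains_exp R_dedekind pmax pn0 hann (N0P x1 Gx1).
  rewrite leq_eqVlt => /predU1P[-> //|]; rewrite ltnS => jN ej.
  by have := ideal_exp_le jN pr0; rewrite -ej.
have hpN := ideal_exp_ideal p N'.+1.
have [|x Gx|x Gx|k [e [g [gG ggen grel]]]] := IHm N L' _ hL' L'G.
- have lt1 := proper_card prop; have le1 := max_card (mem (rep_set L')).
  by apply: leq_trans (ltn_sub2l (leq_trans lt1 le1) lt1) _; rewrite -ltnS.
- by have [t Lt] := Lrep x Gx; exists t; apply: LL'.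
- by move=> r pr; apply: LL'; apply: GN pr.
have hrho j : exists rho : R, ideal_kills (ideal_exp p (e j)) L (g j - rho%:F *: x1).
  have gj r : L' (r%:F *: g j) <-> ideal_exp p (e j) r.
    have := grel (fun i => if i == j then r else 0).
    rewrite (bigD1 j) //= eqxx big1 ?addr0 => [->|i /negPf->]; last first.
      by rewrite tofrac0 scale0r.
    split=> [/(_ j)|pr i]; first by rewrite eqxx.
    by case: eqP => [->//|_]; apply: ideal0; apply: ideal_exp_ideal.
  apply: (lift_annihilator (a1 := ideal_exp p N'.+1)) => //.
  - exact: ideal_exp_ideal.
  - exact: ideal_exp_neq0.
  - by move=> r pr; apply/gj; apply: LL'; apply: N0P.
  - by move=> r Lr; rewrite -x1_ann.
  - exact: N0P.
  - by move=> r /gj.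
pose rho j := projT1 (cid (hrho j)); pose g' j := g j - (rho j)%:F *: x1.
have g'P j : ideal_kills (ideal_exp p (e j)) L (g' j) by rewrite /g' /rho; case: cid.
have sum_g r : \sum_j (r j)%:F *: g j =
    \sum_j (r j)%:F *: g' j + (\sum_j r j * rho j)%:F *: x1.
  rewrite rmorph_sum scaler_suml -big_split; apply: eq_bigr => j _ /=.
  by rewrite tofracM -scalerA -scalerDr subrK.
exists k.+1, (cons_ord N'.+1 e), (cons_ord x1 g'); split.
- move=> i; rewrite /cons_ord; case: unlift => // j.
  by apply: submoduleB => //; apply: submoduleZ.
- move=> y Gy; have [r [s Ls]] := ggen y Gy.
  exists (cons_ord (\sum_j r j * rho j + s) r); rewrite big_ord_recl !cons_ord0.
  rewrite [X in _ *: x1 + X](eq_bigr (fun j => (r j)%:F *: g' j)); last first.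
    by move=> j _; rewrite !cons_ordS.
  move: Ls; rewrite sum_g tofracD scalerDl; congr (L _).
  by rewrite -addrA -opprD; congr (y - _); rewrite -[LHS]addrA addrC.
- move=> r; rewrite big_ord_recl !cons_ord0.
  under eq_bigr => j _ do rewrite !cons_ordS.
  set r' := fun j => r (lift ord0 j); split.
  + move=> Lr.
    (* Modulo [L'] the relation involves the [g j] alone, so their coefficients are known first; the
       term in [x1] is then isolated modulo [L]. *)
    have pr : forall j, ideal_exp p (e j) (r' j).
      apply/grel; exists (\sum_j r' j * rho j - r ord0).
      by rewrite sum_g tofracB scalerBl opprB addrACA subrr addr0 addrC.
    have Lg : L (\sum_j (r' j)%:F *: g' j).
      by apply: submodule_sum => // j _; apply: g'P.
    move=> i; rewrite /cons_ord; case: unliftP => [j ->|->]; first exact: pr.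
    rewrite -x1_ann /=; have := submoduleB hL Lr Lg; rewrite addrK; apply.
  + move=> pr; apply: submoduleD => //.
      by have := pr ord0; rewrite cons_ord0 -x1_ann.
    apply: submodule_sum => // j _; apply: g'P.
    by have := pr (lift ord0 j); rewrite cons_ordS.
Qed.

End PrimaryModules.

(** * Overorders *)

Section Envelope.
Variables (R : idomainType) (A : falgType {fraction R}).
Local Notation K := {fraction R}.
Implicit Types (L M Lam Gam B : set A) (x y : A) (p : set R).

(** All that the remaining study of overorders takes from the trace form: a lattice [B] around every
    overorder, with representatives [rep] of its finitely many classes modulo [Lam]. *)
Record order_envelope Lam B (T : finType) (rep : T -> A) : Prop := OrderEnvelope {
  envelope_submodule : is_submodule B;
  envelope_overorder : forall Gam, overorder Lam Gam -> Gam `<=` B;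
  envelope_order : forall L, is_submodule L -> Lam `<=` L ->
    (forall x y, L x -> L y -> L (x * y)) -> L `<=` B -> is_order L;
  envelope_torsion : exists2 d : R, d != 0 & forall x, B x -> Lam (d%:F *: x);
  envelope_rep : forall x, B x -> exists t, Lam (x - rep t) }.

Lemma exists_order_envelope (tr : A -> K) Lam : is_dedekind R -> residually_finite R ->
  is_reduced_trace tr -> trace_form_nondegenerate tr -> is_order Lam ->
  exists (B : set A) (T : finType) (rep : T -> A), order_envelope Lam B rep.
Proof.
move=> Rd Rfin tr_red tr_nondeg hL; have hsub := order_submodule hL.
have [b0 hb bL] := order_basis hL.
pose b := in_tuple b0; pose n := size b0.
have bL' (j : 'I_n) : Lam b`_j by apply: bL; apply: mem_nth.
have [d d0 dB] := overorder_bounded Rd tr_red tr_nondeg (b := b) hb hL bL'.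
have dF : d%:F != 0 :> K by rewrite tofrac_eq0.
have [s sP] := Rfin _ (principal_ideal d) (nonzero_ideal (principal_id d) d0).
(* A coordinate [r / d] matters modulo [R] only through [r] modulo [d], and [s] represents these
   residues. *)
pose rep (t : {ffun 'I_n -> 'I_(size s)}) : A :=
  \sum_(j < n) ((s`_(t j))%:F / d%:F) *: b`_j.
exists [set x | forall j, in_base (d%:F * coord b j x)], {ffun 'I_n -> 'I_(size s)}, rep.
have coordE x : x = \sum_j coord b j x *: b`_j by exact: (coord_basis (X := b) hb (memvf x)).
split.
- split=> [j|x y hx hy j|r x hx j].
  + by rewrite linear0 mulr0; apply: in_base0.
  + by rewrite linearD mulrDr; apply: in_baseD; [exact: hx|exact: hy].
  + by rewrite linearZ /= mulrCA; apply: in_baseM; [exact: in_base_tofrac|exact: hx].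
- by move=> Gam hG x Gx j; apply: dB Gx.
- move=> L hL' LamL LM LB; apply: (@bounded_order _ _ Rd _ b Lam L d) => //.
  by move=> x j /LB.
- exists d => // x hx; rewrite (coordE x) scaler_sumr.
  by apply: submodule_sum => // j _; rewrite scalerA; apply: submodule_in_base.
move=> x hx.
have ht j : exists t : 'I_(size s), in_base (coord b j x - (s`_t)%:F / d%:F).
  have [r er] := hx j; have [y ys [q eq]] := sP r.
  have lt_y : (index y s < size s)%N by rewrite index_mem.
  exists (Ordinal lt_y), q => /=; rewrite nth_index //.
  apply: (mulfI dF); rewrite mulrBr er mulrCA mulfV // mulr1 -tofracB eq.
  by rewrite tofracM mulrC.
exists [ffun j => projT1 (cid (ht j))]; rewrite {1}(coordE x) -sumrB.
apply: submodule_sum => // j _; rewrite ffunE -scalerBl.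
by apply: submodule_in_base => //; case: cid.
Qed.

End Envelope.

Section Overorders.
Variables (R : idomainType) (A : falgType {fraction R}) (Lam B : set A).
Variables (T : finType) (rep : T -> A).
Local Notation K := {fraction R}.
Implicit Types (L M Gam Del : set A) (x y : A) (p : set R).
Hypothesis R_dedekind : is_dedekind R.
Hypothesis Lam_order : is_order Lam.
Hypothesis env : order_envelope Lam B rep.

Let Lam_submodule : is_submodule Lam := order_submodule Lam_order.

Lemma overorder_refl : overorder Lam Lam. Proof. by split. Qed.

Lemma overorder_rep Gam x : overorder Lam Gam -> Gam x -> exists t, Lam (x - rep t).
Proof. by move=> hG Gx; apply: (envelope_rep env); apply: (envelope_overorder env) Gx. Qed.

Lemma overorder_proper Gam Del : overorder Lam Gam -> overorder Lam Del ->
  Gam `<=` Del -> Gam <> Del -> rep_set rep Gam \proper rep_set rep Del.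
Proof.
move=> hG hD GD nGD.
have [x [Dx nGx]] : exists x, Del x /\ ~ Gam x.
  apply: contrapT => h; apply: nGD; apply/seteqP; split=> // x Dx.
  by apply: contrapT => nGx; apply: h; exists x.
apply: (rep_set_proper (x := x)) => //.
- by case: hG => /order_submodule.
- by case: hD => /order_submodule.
- by have [t Lt] := overorder_rep hD Dx; exists t; case: hG => _; apply.
Qed.

Lemma overorder_rep_inj Gam Del : overorder Lam Gam -> overorder Lam Del ->
  rep_set rep Gam = rep_set rep Del -> Gam = Del.
Proof.
wlog suff H : Gam Del / overorder Lam Gam -> overorder Lam Del ->
    rep_set rep Gam = rep_set rep Del -> Gam `<=` Del.
  by move=> hG hD e; apply/seteqP; split; apply: H.
move=> hG [hD LD] e x Gx; have [t Lt] := overorder_rep hG Gx; have [hG' LG] := hG.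
rewrite -[x](subrK (rep t)); apply: (submoduleD (order_submodule hD)); first exact: LD.
apply/(in_rep_set rep Del t); rewrite -e; apply/(in_rep_set rep Gam t).
rewrite -[rep t](subKr x); apply: (submoduleB (order_submodule hG')) => //; exact: LG.
Qed.

Lemma exists_minimal_overorder Gam Del : overorder Lam Gam -> overorder Lam Del ->
  Gam `<=` Del -> Gam <> Del -> exists2 Gam', minimal_overorder Gam Gam' & Gam' `<=` Del.
Proof.
move=> hG; have [m] := ubnP #|rep_set rep Del|; elim: m Del => // m IHm Del Dm hD GD nGD.
have [hmin|] := pselect (minimal_overorder Gam Del); first by exists Del.
move=> nmin; have [E [hE GE ED nEG nED]] : exists E,
    [/\ is_order E, Gam `<=` E, E `<=` Del, E <> Gam & E <> Del].
  apply: contrapT => h; apply: nmin; split.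
  - by case: hD.
  - by move=> e; apply: nGD.
  - move=> E hE GE ED; apply: contrapT => /not_orP[? ?].
    by apply: h; exists E.
have hE' : overorder Lam E by split=> //; apply: subset_trans GE; case: hG.
have lt_card := proper_card (overorder_proper hE' hD ED nED).
have [||Gam' hmin sub] := IHm E _ hE' GE.
- exact: leq_trans lt_card Dm.
- by move=> e; apply: nEG.
by exists Gam' => //; apply: subset_trans ED.
Qed.

Definition primary_at p x : Prop := exists N, ideal_kills (ideal_exp p N) Lam x.

Lemma primary_submodule p : is_submodule (primary_at p).
Proof.
split.
- by exists 0%N => r _; rewrite scaler0; apply: submodule0.
- move=> x y [M hx] [N hy]; exists (maxn M N) => r pr; rewrite scalerDr.
  apply: submoduleD => //; [apply: hx|apply: hy]; apply: ideal_exp_le pr.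
    exact: leq_maxl.
  exact: leq_maxr.
- move=> s x [M hx]; exists M => r pr; rewrite scalerA mulrC -scalerA.
  by apply: submoduleZ => //; apply: hx.
Qed.

Lemma primary_mul p x y : primary_at p x -> primary_at p y -> primary_at p (x * y).
Proof.
move=> [M hx] [N hy]; exists (M + N)%N; rewrite ideal_expD.
apply: (@ideal_mul_min _ _ _ [set r : R | Lam (r%:F *: (x * y))]).
  exact: conductor_ideal.
move=> u v pu pv /=; rewrite tofracM -scalerA scalerAr scalerAl.
by apply: orderM => //; [apply: hx|apply: hy].
Qed.

Lemma primary_of_Lam p : Lam `<=` primary_at p.
Proof. by move=> x Lx; exists 0%N => r _; apply: submoduleZ. Qed.

(** The exponent may vary with the element here; finiteness makes it uniform in
    [primary_overorder_uniform]. *)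
Definition primary_overorder p Gam : Prop := overorder Lam Gam /\ Gam `<=` primary_at p.

Lemma primary_overorder_uniform p Gam : primary_overorder p Gam ->
  exists N, forall x, Gam x -> ideal_kills (ideal_exp p N) Lam x.
Proof.
move=> [hG Gp].
have h t : exists N, Gam (rep t) -> ideal_kills (ideal_exp p N) Lam (rep t).
  have [/Gp[N hN]|nG] := pselect (Gam (rep t)); first by exists N.
  by exists 0%N.
pose f t := projT1 (cid (h t)); exists (\max_t f t) => x Gx r pr.
have [t Lt] := overorder_rep hG Gx; have [hG' LG] := hG.
rewrite -[x](subrK (rep t)) scalerDr; apply: submoduleD => //; first exact: submoduleZ.
have Gt : Gam (rep t).
  by rewrite -[rep t](subKr x); apply: (submoduleB (order_submodule hG')) => //; apply: LG.
have := projT2 (cid (h t)) Gt; apply; apply: ideal_exp_le pr.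
exact: (leq_bigmax t).
Qed.

(** The index ideal kills the quotient. Conversely a cyclic decomposition with annihilators
    [p ^ e j] has index ideal [p] to the sum of the [e j]. *)
Lemma p_overorderE p Gam : nonzero_prime p ->
  p_overorder p Lam Gam <-> primary_overorder p Gam.
Proof.
move=> pp; have [[hp _ _] pn0] := pp; split=> [[hG [N hN]]|hG].
  split=> // x Gx; exists N; exact: index_ideal_kills hN Gx.
have [hGo _] := hG; have [hG' LG] := hGo.
have [N hN] := primary_overorder_uniform hG.
have [k [e [g [gG ggen grel]]]] := primary_cyclic_decomposition R_dedekind pp
  (order_submodule hG') Lam_submodule LG (fun x => overorder_rep hGo) hN.
split=> //; exists (\sum_j e j)%N, k, (fun j => ideal_exp p (e j)), g; split=> //.
  by move=> j; split; [exact: ideal_exp_ideal|exact: ideal_exp_neq0].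
by rewrite big_ideal_mul_exp.
Qed.

(* By minimality [Gam + p Gam'] is [Gam] or [Gam']; the latter is excluded by
   Nakayama's lemma. *)
Lemma minimal_overorder_scale p Gam Gam' : nonzero_prime p -> overorder Lam Gam ->
  primary_overorder p Gam' -> minimal_overorder Gam Gam' ->
  Gam' `<=` ideal_inv_scale p Gam.
Proof.
move=> pp hG hG' [[hGo' GG'] nG'G Gmin]; have [[hp _ _] pn0] := pp.
have [hGo LG] := hG; have [hG's _] := hG'.
have [sG sG'] := (order_submodule hGo, order_submodule hGo').
pose P := Rspan [set z | exists r x, [/\ p r, Gam' x & z = r%:F *: x]].
have sP : is_submodule P by apply: Rspan_submodule.
have PG' : P `<=` Gam'.
  by apply: Rspan_min => // _ [r [x [_ Gx ->]]]; apply: submoduleZ.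
have PMr x y : P x -> Gam' y -> P (x * y).
  move=> Px Gy; move: x Px; apply: Rspan_min; first exact: submodule_preim_mulr.
  move=> _ [r [x [pr Gx ->]]] /=; apply: Rspan_subset; exists r, (x * y).
  by rewrite scalerAl; split=> //; apply: orderM.
have PMl x y : Gam' x -> P y -> P (x * y).
  move=> Gx Py; move: y Py; apply: Rspan_min; first exact: submodule_preim_mull.
  move=> _ [r [y [pr Gy ->]]] /=; apply: Rspan_subset; exists r, (x * y).
  by rewrite scalerAr; split=> //; apply: orderM.
(* [P] is [p Gam'], a two-sided ideal of [Gam'], so [J = Gam + P] is a ring. *)
pose J : set A := [set x | exists u, Gam u /\ P (x - u)].
have GJ : Gam `<=` J by move=> u Gu; exists u; rewrite subrr; split=> //; apply: submodule0.
have PJ : P `<=` J by move=> u Pu; exists 0; rewrite subr0; split=> //; apply: submodule0.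
have JG' : J `<=` Gam'.
  move=> x [u [Gu /PG' Pxu]]; rewrite -[x](subrK u); apply: submoduleD => //.
  exact: GG'.
have sJ : is_submodule J.
  split; first by apply: GJ; apply: submodule0.
    move=> x y [u [Gu Pu]] [v [Gv Pv]]; exists (u + v); split; first exact: submoduleD.
    by rewrite opprD addrACA; apply: submoduleD.
  move=> r x [u [Gu Pu]]; exists (r%:F *: u); split; first exact: submoduleZ.
  by rewrite -scalerBr; apply: submoduleZ.
have JM x y : J x -> J y -> J (x * y).
  move=> Jx Jy; have [u [Gu Pu]] := Jx; have [v [Gv Pv]] := Jy.
  exists (u * v); split; first exact: orderM.
  have -> : x * y - u * v = (x - u) * y + u * (y - v) by rewrite mulrBl mulrBr addrA subrK.
  by apply: submoduleD => //; [apply: PMr => //; apply: JG'|apply: PMl => //; apply: GG'].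
have JB : J `<=` B by apply: subset_trans JG' _; apply: (envelope_overorder env).
have LJ : Lam `<=` J by apply: subset_trans LG GJ.
have [JG|eJ] := Gmin J (envelope_order env sJ LJ JM JB) GJ JG'.
  (* Here [p Gam'] lies in [Gam], and [x = \sum u (v x)] with [\sum u * v = 1] puts [x] in
     [p^-1 Gam]. *)
  have [s [hs es]] := ideal_invertible R_dedekind hp pn0.
  move=> x Gx; exists [seq (i.1, i.2%:F *: x) | i <- s]; split.
    move=> _ /mapP[i /hs[pi1 pi2] ->]; split=> //=; rewrite -JG; apply: PJ.
    by apply: Rspan_subset; exists i.2, x.
  rewrite big_map -[LHS]scale1r -es scaler_suml; apply: eq_bigr => i _.
  by rewrite scalerA.
case: nG'G; apply/seteqP; split=> //.
have [N hN] := primary_overorder_uniform hG'.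
(* Nakayama by hand: [Gam' = Gam + p Gam'] lowers the exponent of a power of [p] sending [Gam'] into
   [Gam], from [N] down to 0. *)
suff H n : (n <= N)%N -> forall x, Gam' x -> ideal_kills (ideal_exp p (N - n)) Gam x.
  move=> x Gx; have := H N (leqnn N) x Gx 1.
  by rewrite subnn tofrac1 scale1r; apply.
elim: n => [_ x Gx r|n IHn nN x Gx r pr].
  by rewrite subn0 => pr; apply: LG; apply: hN.
have : J x by rewrite eJ.
case=> u [Gu Pu]; rewrite -[x](subrK u) scalerDr; apply: submoduleD => //; last first.
  exact: submoduleZ.
move: (x - u) Pu; apply: Rspan_min; first exact: submodule_preim_scale.
move=> _ [q [z [pq Gz ->]]] /=; rewrite scalerA -tofracM mulrC; apply: IHn => //.
  exact: ltnW.
by rewrite -(subnSK nN); apply: mem_ideal_mul.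
Qed.

End Overorders.

(** * The procedure *)

Section Procedure.
Variables (R : idomainType) (A : falgType {fraction R}) (Lam B : set A).
Variables (T : finType) (rep : T -> A).
Local Notation K := {fraction R}.
Implicit Types (L M Gam Del : set A) (x y : A) (st : state A).
Hypothesis R_dedekind : is_dedekind R.
Hypothesis Lam_order : is_order Lam.
Hypothesis env : order_envelope Lam B rep.
Variable p : set R.
Hypothesis p_prime : nonzero_prime p.

Let Lam_submodule : is_submodule Lam := order_submodule Lam_order.

(* A step replaces an element by larger ones, at most [2 ^ #|T|] in number. *)
Definition rep_weight (X : {set T}) : nat := (#|{set T}|.+1 ^ (#|T| - #|X|))%N.

(** Summing over shadows keeps the sum finite for an arbitrary set of orders; overorders are
    determined by their shadows. *)
Definition state_weight (S : set (set A)) : nat :=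
  (\sum_(X | `[< exists2 Gam, S Gam & rep_set rep Gam = X >]) rep_weight X)%N.

(** The base exceeds the number of subsets of [T], and each larger set has an exponent smaller by at
    least one. *)
Lemma sum_larger_rep_weight (X : {set T}) :
  (\sum_(Y : {set T} | X \proper Y) rep_weight Y < rep_weight X)%N.
Proof.
have [lt0|] := ltnP 0 (#|T| - #|X|); last first.
  rewrite leqn0 subn_eq0 => TX; rewrite big_pred0 ?expn_gt0 // => Y.
  by apply/negP => /proper_card; rewrite ltnNge (leq_trans (max_card _) TX).
rewrite /rep_weight -(prednK lt0) expnS.
apply: (@leq_ltn_trans (\sum_(Y : {set T}) #|{set T}|.+1 ^ (#|T| - #|X|).-1)).
  rewrite big_mkcond leq_sum //= => Y _; case: ifP => // /proper_card XY.
  by rewrite leq_pexp2l // -subnS leq_sub2l.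
by rewrite sum_nat_const cardT -cardE ltn_mul2r expn_gt0 /=.
Qed.

Lemma procedure_step_overorder st st' : procedure_step p st st' ->
  st.2 `<=` overorder Lam -> st'.2 `<=` overorder Lam.
Proof.
case=> Gam SGam -> hS Del /= [[/hS//]|[[[hD GD] _ _] _]].
by split=> //; apply: subset_trans GD; case: (hS _ SGam).
Qed.

Lemma procedure_step_weight st st' : procedure_step p st st' ->
  st.2 `<=` overorder Lam -> (state_weight st'.2 < state_weight st.2)%N.
Proof.
move=> hstep hS; have hS' := procedure_step_overorder hstep hS.
case: hstep => Gam SGam est'; rewrite est' /= in hS' *.
set N := [set _ | _ /\ _] in hS' *; have hG := hS _ SGam.
rewrite [X in (_ < X)%N](bigD1 (rep_set rep Gam)) /=; last first.
  by apply/asboolP; exists Gam.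
apply: leq_ltn_trans (_ : (_ <= (\sum_(X | `[< exists2 Gam, st.2 Gam & rep_set rep Gam = X >] &&
   (X != rep_set rep Gam)) rep_weight X + \sum_(Y : {set T} | rep_set rep Gam \proper Y) rep_weight Y))%N) _.
  rewrite /state_weight big_mkcond [X in (_ <= X + _)%N]big_mkcond.
  rewrite [X in (_ <= _ + X)%N]big_mkcond -big_split leq_sum //= => X _.
  case: asboolP => // -[Del SDel eX]; case: SDel => [[SDel nDG]|[[hD nDG Dmin] _]].
    rewrite (_ : `[< _ >] && _ = true) ?leq_addr //; apply/andP; split.
      by apply/asboolP; exists Del.
    apply/eqP => eXG; apply: nDG; rewrite /=; apply: (overorder_rep_inj env) => //.
      exact: hS.
    by rewrite eX.
  have [hDo GD] := hD.
  rewrite (_ : _ \proper X = true) ?leq_addl // -eX.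
  apply: (overorder_proper env) => //; last by move=> e; apply: nDG.
  by split=> //; apply: subset_trans GD; case: hG.
by rewrite addnC ltn_add2r sum_larger_rep_weight.
Qed.

Lemma procedure_acc st : st.2 `<=` overorder Lam ->
  Acc (fun st' st => procedure_step p st st') st.
Proof.
have [m] := ubnP (state_weight st.2); elim: m st => [st|m IHm st stm hS].
  by rewrite ltn0.
constructor=> st' hstep; apply: IHm; last exact: procedure_step_overorder hstep hS.
exact: leq_trans (procedure_step_weight hstep hS) _.
Qed.

Lemma procedure_terminates_overorders : procedure_terminates p Lam.
Proof. by apply: procedure_acc => _ ->; apply: overorder_refl. Qed.

(** From [Gam'] inside [p^-1 Gam] one gets [p Gam'] inside [Gam], so the exponent grows by at most
    one. *)
Lemma new_primary Gam Gam' : primary_overorder Lam p Gam -> minimal_overorder Gam Gam' ->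
  Gam' `<=` ideal_inv_scale p Gam -> primary_overorder Lam p Gam'.
Proof.
move=> hG [[hGo' GG'] _ _] G'p; have [[hGo LG] Gp] := hG.
split; first by split=> //; apply: subset_trans GG'.
have [N hN] := primary_overorder_uniform Lam_order env hG.
have hp := ideal_exp_ideal p.
move=> x /G'p[s [hs ->]]; exists N.+1.
apply: (@ideal_mul_min _ _ _ [set r : R | Lam (r%:F *: (\sum_(i <- s) i.1 *: i.2))]).
  exact: conductor_ideal.
move=> u v pu pv /=; rewrite scaler_sumr; apply: submodule_sum => // i /hs[pi Gi].
have [t et] := pi u pu; rewrite scalerA tofracM -mulrA mulrCA [u%:F * _]mulrC et.
by rewrite mulrC -scalerA; apply: submoduleZ => //; apply: hN.
Qed.

(** The last clause says that processed orders have all their successors in the first component;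
    once the work set is empty, it is plain closure. *)
Definition procedure_invariant st : Prop :=
  [/\ st.1 `<=` primary_overorder Lam p, st.2 `<=` st.1, st.1 Lam
    & forall Gam Gam', st.1 Gam -> ~ st.2 Gam -> minimal_overorder Gam Gam' ->
        Gam' `<=` ideal_inv_scale p Gam -> st.1 Gam'].

Lemma initial_invariant : procedure_invariant (initial_state Lam).
Proof.
split=> //= _ ->.
by split; [apply: overorder_refl|apply: primary_of_Lam].
Qed.

Lemma step_invariant st st' : procedure_step p st st' ->
  procedure_invariant st -> procedure_invariant st'.
Proof.
case=> Gam SGam -> [Tp ST TLam Tclosed]; split=> /=.
- move=> Del [/Tp//|[hmin sub]].
  by apply: (new_primary _ hmin sub); apply/Tp/ST.
- by move=> Del [[/ST ? _]|?]; [left|right].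
- by left.
- move=> Del Del' [TDel|NDel] nS hmin sub; last by case: nS; right.
  (* Only [Gam] can have left the work set, and its successors are exactly the orders just added. *)
  have [e|nDG] := pselect (Del = Gam); first by right; rewrite e in hmin sub.
  by left; apply: (Tclosed Del) => // SDel; apply: nS; left.
Qed.

Lemma run_invariant st st' : clos_refl_trans _ (procedure_step p) st st' ->
  procedure_invariant st -> procedure_invariant st'.
Proof.
elim=> [u v|//|u v w _ IH1 _ IH2]; first exact: step_invariant.
by move=> /IH1/IH2.
Qed.

Lemma final_state (S : set (set A)) : procedure_invariant (S, set0) ->
  S = primary_overorder Lam p.
Proof.
case=> /= Sp _ SLam Sclosed; apply/seteqP; split=> // Del hDel.
have [hD Dp] := hDel; have [hDo LD] := hD.
(* Climb from [Lam] towards [Del] through minimal overorders inside [Del]; the room left in [T]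
   bounds the climb. *)
suff H Gam : S Gam -> Gam `<=` Del -> S Del by exact: (H Lam).
have [m] := ubnP (#|T| - #|rep_set rep Gam|)%N; elim: m Gam => // m IHm Gam Gm SGam GD.
have [<- //|nGD] := pselect (Gam = Del).
have [hG Gp] := Sp _ SGam; have [hGo LG] := hG.
have [Gam' hmin G'D] := exists_minimal_overorder env hG hD GD nGD.
have [[hGo' GG'] nG'G _] := hmin.
have hG' : overorder Lam Gam' by split=> //; apply: subset_trans GG'.
have hpG' : primary_overorder Lam p Gam' by split=> //; apply: subset_trans Dp.
apply: (IHm Gam') => //.
  have lt1 : (#|rep_set rep Gam| < #|rep_set rep Gam'|)%N.
    by apply/proper_card/(overorder_proper env) => // e; apply: nG'G.
  have le1 := max_card (mem (rep_set rep Gam')).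
  by apply: leq_trans (ltn_sub2l (leq_trans lt1 le1) lt1) _; rewrite -ltnS.
apply: (Sclosed Gam) => //.
exact: (minimal_overorder_scale R_dedekind Lam_order env p_prime hG hpG' hmin).
Qed.

(** Accessibility only excludes infinite runs; a result exists because a state with non-empty work
    set always admits a step. *)
Lemma exists_complete_run st : Acc (fun st' st => procedure_step p st st') st ->
  exists S, clos_refl_trans _ (procedure_step p) st (S, set0).
Proof.
elim=> {}st _ IH; have [S0|/existsNP[Gam /contrapT SGam]] := pselect (forall Gam, ~ st.2 Gam).
  exists st.1; case: st S0 {IH} => U S /= S0; rewrite (_ : S = set0); first exact: rt_refl.
  by apply/seteqP; split=> // Gam /S0.
have hstep : procedure_step p st (st.1 `|` [set Gam' | minimal_overorder Gam Gam' /\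
    Gam' `<=` ideal_inv_scale p Gam], (st.2 `\ Gam) `|` [set Gam' |
    minimal_overorder Gam Gam' /\ Gam' `<=` ideal_inv_scale p Gam]) by exists Gam.
have [S run] := IH _ hstep; exists S; apply: rt_trans run; exact: rt_step.
Qed.

Lemma procedure_returnsE (S : set (set A)) :
  procedure_returns p Lam S <-> S = primary_overorder Lam p.
Proof.
have ret S' : procedure_returns p Lam S' -> S' = primary_overorder Lam p.
  by move=> /run_invariant/(_ initial_invariant)/final_state.
split; first exact: ret.
move=> ->; have [S' run] := exists_complete_run procedure_terminates_overorders.
by rewrite -(ret S' run).
Qed.

End Procedure.

(** * Primary decomposition of overorders *)

Section PrimaryDecomposition.
Variables (R : idomainType) (A : falgType {fraction R}) (Lam B : set A).
Variables (T : finType) (rep : T -> A).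
Local Notation K := {fraction R}.
Implicit Types (L M Gam Del : set A) (x y : A).
Hypothesis R_dedekind : is_dedekind R.
Hypothesis Lam_order : is_order Lam.
Hypothesis env : order_envelope Lam B rep.
Variables (r : nat) (p : 'I_r -> set R).
Hypothesis p_inj : injective p.
Hypothesis p_prime : forall i, nonzero_prime (p i).

Let Lam_submodule : is_submodule Lam := order_submodule Lam_order.

Lemma order_sum0 (L : 'I_r -> set A) : r = 0%N -> order_sum Lam L = Lam.
Proof. by move/eqP; rewrite /order_sum => ->. Qed.

Lemma order_sum_submodule (L : 'I_r -> set A) : (forall i, is_submodule (L i)) ->
  is_submodule (order_sum Lam L).
Proof.
move=> hL; rewrite /order_sum; case: eqP => // _; split.
- by exists (fun=> 0); split=> [i|]; [apply: submodule0|rewrite big1].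
- move=> _ _ [y [Ly ->]] [z [Lz ->]]; exists (fun i => y i + z i).
  by split=> [i|]; [apply: submoduleD|rewrite big_split].
- move=> c _ [y [Ly ->]]; exists (fun i => c%:F *: y i).
  by split=> [i|]; [apply: submoduleZ|rewrite scaler_sumr].
Qed.

Lemma order_sum_mem (L : 'I_r -> set A) i : (forall i, is_submodule (L i)) ->
  L i `<=` order_sum Lam L.
Proof.
move=> hL x Lx; rewrite /order_sum; case: eqP => [r0|_].
  by have := leq_ltn_trans (leq0n i) (ltn_ord i); rewrite r0.
exists (fun j => if j == i then x else 0); split; last by rewrite -big_mkcond big_pred1_eq.
by move=> j; case: eqP => [->|_] //; apply: submodule0.
Qed.

Lemma order_sum_base (L : 'I_r -> set A) : (forall i, is_submodule (L i)) ->
  (forall i, Lam `<=` L i) -> Lam `<=` order_sum Lam L.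
Proof.
move=> hL LamL x Lx; have [r0|] := eqVneq r 0%N; first by rewrite order_sum0.
rewrite -lt0n => r0; apply: (@order_sum_mem L (Ordinal r0) hL).
exact: LamL.
Qed.

Lemma order_sum_min (L : 'I_r -> set A) M : is_submodule M -> Lam `<=` M ->
  (forall i, L i `<=` M) -> order_sum Lam L `<=` M.
Proof.
move=> hM LM LiM x; rewrite /order_sum; case: eqP => [_ /LM //|_ [y [Ly ->]]].
by apply: submodule_sum => // i _; apply: (LiM i).
Qed.

(** The point is closure under products. For [x] in [L i] and [y] in [L j] with distinct primes, a
    power of [p i] sends [x * y] into [L j] and a power of [p j] sends it into [L i]; the powers are
    comaximal. *)
Lemma order_sum_overorder (L : 'I_r -> set A) :
  (forall i, primary_overorder Lam (p i) (L i)) -> overorder Lam (order_sum Lam L).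
Proof.
move=> hL; have hLo i : is_order (L i) by case: (hL i) => -[].
have sL i := order_submodule (hLo i).
have LamL i : Lam `<=` L i by case: (hL i) => -[].
have sS := order_sum_submodule sL; have LamS := order_sum_base sL LamL.
split=> //; apply: (envelope_order env) => //; last first.
  apply: order_sum_min; first exact: envelope_submodule env.
    by apply: (envelope_overorder env); apply: overorder_refl.
  by move=> i; apply: (envelope_overorder env); split.
have mulS i j x y : L i x -> L j y -> order_sum Lam L (x * y).
  move=> Lx Ly; have [eij|nij] := eqVneq i j.
    by subst j; apply: (order_sum_mem (i := i) sL); apply: orderM.
  have [[_ Pi] [_ Pj]] := (hL i, hL j).
  have [M hx] := Pi x Lx; have [N hy] := Pj y Ly.
  have pimax := nonzero_prime_maximal R_dedekind (p_prime i).
  have pjmax := nonzero_prime_maximal R_dedekind (p_prime j).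
  have [[hpi _ _] [hpj npj1 _]] := (pimax, pjmax).
  have co : coideal (p i) (p j).
    apply: coideal_maximal => // sub; case: pimax => _ _ /(_ _ hpj sub)[e|e].
      by case/eqP: nij; apply: p_inj.
    by apply: npj1; rewrite e.
  apply: (coideal_submodule sS (coideal_expexp M N hpi hpj co)) => c pc.
    rewrite scalerAl; apply: (order_sum_mem (i := j) sL); apply: orderM => //.
    by apply: LamL; apply: hx.
  rewrite scalerAr; apply: (order_sum_mem (i := i) sL); apply: orderM => //.
  by apply: LamL; apply: hy.
have [r0|r0] := eqVneq r 0%N.
  by rewrite order_sum0 //; apply: orderM.
have eS : order_sum Lam L = [set x | exists y : 'I_r -> A, (forall i, L i (y i)) /\ x = \sum_i y i].
  by rewrite /order_sum (negPf r0).
move=> x y; rewrite {1 2}eS => -[u [Lu ->]] [v [Lv ->]].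
rewrite mulr_suml; apply: submodule_sum => // i _.
by rewrite mulr_sumr; apply: submodule_sum => // j _; apply: (mulS i j).
Qed.

Definition primary_part (q : set R) Gam : set A := Gam `&` primary_at Lam q.

Lemma primary_part_overorder (q : set R) Gam : overorder Lam Gam ->
  primary_overorder Lam q (primary_part q Gam).
Proof.
move=> hG; have [hGo LG] := hG; have sG := order_submodule hGo.
have sP := primary_submodule Lam_order q.
have LP : Lam `<=` primary_part q Gam.
  by move=> x Lx; split; [exact: LG|exact: primary_of_Lam].
split; last by move=> x [].
split=> //; apply: (envelope_order env) => //.
- split; first by split; apply: submodule0.
    by move=> x y [? ?] [? ?]; split; apply: submoduleD.
  by move=> c x [? ?]; split; apply: submoduleZ.
- by move=> x y [? ?] [? ?]; split; [apply: orderM|apply: primary_mul].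
- by move=> x [Gx _]; apply: (envelope_overorder env) Gx.
Qed.

(* Splits [q]-primary parts off along a product of primes killing [x]. *)
Lemma overorder_sub_order_sum Gam : overorder Lam Gam ->
  (forall q, nonzero_prime q -> (forall i, q <> p i) -> primary_part q Gam `<=` Lam) ->
  Gam `<=` order_sum Lam (fun i => primary_part (p i) Gam).
Proof.
move=> hG only_p; have [hGo LG] := hG; have sG := order_submodule hGo.
set L := fun i => primary_part (p i) Gam.
have hL i : primary_overorder Lam (p i) (L i) by apply: primary_part_overorder.
have sL i : is_submodule (L i) by case: (hL i) => -[/order_submodule].
have LamL i : Lam `<=` L i by case: (hL i) => -[].
have sS := order_sum_submodule sL; have LamS := order_sum_base sL LamL.
have kill_prod n : forall (s : seq (set R)) x, (size s <= n)%N ->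
    (forall q, q \in s -> nonzero_prime q) -> Gam x ->
    ideal_kills (ideal_prod s) Lam x -> order_sum Lam L x.
  elim: n => [|n IHn] s x.
    rewrite leqn0 size_eq0 => /eqP-> _ _ Lx; apply: LamS.
    by rewrite -[x]scale1r -tofrac1; apply: Lx.
  case: s => [|q s]; first by move=> _; apply: IHn.
  move=> ssz hs Gx sx; pose P := pred1 q.
  have hq := hs q (mem_head _ _); have qmax := nonzero_prime_maximal R_dedekind hq.
  have [hqi nq1 _] := qmax.
  pose s1 := filter P (q :: s); pose s2 := filter (predC P) (q :: s).
  have s1E : ideal_prod s1 = ideal_exp q (size s1).
    rewrite ideal_expE; congr ideal_prod; apply/all_pred1P; exact: filter_all.
  have hs2 t : t \in s2 -> nonzero_prime t by rewrite mem_filter => /andP[_ /hs].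
  have co : coideal (ideal_prod s2) q.
    apply: coideal_maximal => //; first exact: ideal_prod_ideal.
    case/(prime_ideal_prod hq.1) => t ts2 tq.
    have [_ _ tmax] := nonzero_prime_maximal R_dedekind (hs2 t ts2).
    have [e|e] := tmax q hqi tq; last by apply: nq1; rewrite e.
    by move: ts2; rewrite mem_filter /= -e eqxx.
  have kill u v : ideal_prod s1 u -> ideal_prod s2 v -> Lam ((u * v)%:F *: x).
    move=> su sv; apply: sx; apply: (@ideal_prod_filter _ P (q :: s)).
    exact: mem_ideal_mul.
  have cok := coideal_exp (size s1) (ideal_prod_ideal s2) hqi co.
  (* Multiples of [x] by the product of [s2] are [q]-primary; multiples by the power of [q] are
     killed by [s2], which is shorter since [q] has gone. *)
  apply: (coideal_submodule sS cok) => c hc.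
    have cP : primary_part q Gam (c%:F *: x).
      split; first exact: submoduleZ.
      by exists (size s1) => u; rewrite -s1E scalerA -tofracM => su; apply: kill.
    have [[i e]|ne] := pselect (exists i, q = p i).
      by apply: (order_sum_mem (i := i) sL); rewrite /L -e.
    by apply: LamS; apply: (only_p q hq _ _ cP) => i e; apply: ne; exists i.
  apply: (IHn s2) => //; last 2 first.
  - exact: submoduleZ.
  - by move=> v hv; rewrite scalerA -tofracM mulrC; apply: kill; rewrite ?s1E.
  by rewrite /s2 /= eqxx /= size_filter (leq_trans (count_size _ _)).
move=> x Gx; have [d d0 dB] := envelope_torsion env.
have Bx : B x by apply: (envelope_overorder env) Gx.
have [|s hs ssub] := nonzero_ideal_contains_prime_prod R_dedekind (conductor_ideal x Lam_submodule).
  by apply: (nonzero_ideal (x := d)) => //; apply: dB.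
by apply: (kill_prod (size s) s x).
Qed.

End PrimaryDecomposition.

Theorem mainTheorem1 (R : idomainType) (A : falgType {fraction R})
    (tr : A -> {fraction R}) (Lam : set A) (r : nat) (p : 'I_r -> set R)
    (R_dedekind : is_dedekind R)
    (R_residually_finite : residually_finite R)
    (A_semisimple : semisimple A)
    (tr_reduced : is_reduced_trace tr)
    (tr_nondegenerate : trace_form_nondegenerate tr)
    (Lam_order : is_order Lam)
    (p_distinct : injective p)
    (p_range : range p = [set q | [/\ is_prime_ideal q, q <> [set 0]
                                 & ideal_divides (ideal_exp q 2) (disc tr Lam)]]) :
  (forall i, procedure_terminates (p i) Lam) /\
  exists S : 'I_r -> set (set A),
    [/\ forall i T, procedure_returns (p i) Lam T <-> T = S i,
        forall i, S i = [set Gam | p_overorder (p i) Lam Gam]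
      & [set Gam | overorder Lam Gam] =
        [set Gam | exists L : 'I_r -> set A,
           (forall i, S i (L i)) /\ Gam = order_sum Lam L]].
Proof.
have [B [T [rep env]]] :=
  exists_order_envelope R_dedekind R_residually_finite tr_reduced tr_nondegenerate Lam_order.
have p_prime i : nonzero_prime (p i).
  have : range p (p i) by exists i.
  by rewrite p_range => -[].
split=> [i|]; first exact: (procedure_terminates_overorders Lam_order env).
exists (fun i => primary_overorder Lam (p i)); split.
- by move=> i S; apply: (procedure_returnsE R_dedekind Lam_order env).
- by move=> i; apply/seteqP; split=> Gam /=;
    rewrite (propext (p_overorderE R_dedekind Lam_order env Gam (p_prime i))).
apply/seteqP; split=> Gam /=; last first.
  by case=> L [hL ->]; apply: (order_sum_overorder R_dedekind Lam_order env p_distinct p_prime hL).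
move=> hG; exists (fun i => primary_part Lam (p i) Gam).
split=> [i|]; first exact: (primary_part_overorder Lam_order env).
apply/seteqP; split.
  (* A prime [q] with primary part beyond [Lam] has the discriminant inside [q ^ 2]; containment is
     divisibility, so [q] is one of the [p i]. *)
  apply: (overorder_sub_order_sum R_dedekind Lam_order env) => // q hq nqp x [Gx [N hN]].
  apply: contrapT => nLx; have [qprime qn0] := hq.
  have : range p q.
    rewrite p_range; split=> //.
    have hqi : is_ideal q by case: qprime.
    apply: (ideal_divides_subset R_dedekind).
    - exact: ideal_gen_ideal.
    - exact: ideal_exp_ideal.
    - exact: ideal_exp_neq0.
    - exact: (disc_sub_prime_sqr R_dedekind tr_reduced hq Lam_order hG Gx nLx hN).
  by case=> i _ e; apply: (nqp i).
case: hG => hGo LG; apply: order_sum_min => //; first exact: order_submodule.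
by move=> i x [].
Qed.
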